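(* Let $X$ be a compact, connected, locally connected Hausdorff space. Every solid-set function $\lambda:\mathscr{A}_s(X)\to\mathbb{R}$ (in the sense of the definition given in the context) extends uniquely to a topological measure on $X$.
   Context: $\mathscr{O}(X)$ and $\mathscr{C}(X)$ are the open and the closed subsets of $X$. The empty set is regarded as connected. A set $A\subseteq X$ is solid if $A$ and $X\setminus A$ are connected; $\mathscr{O}_s(X)$, $\mathscr{C}_s(X)$ are the families of open solid and closed solid sets, and $\mathscr{A}_s(X)=\mathscr{O}_s(X)\cup\mathscr{C}_s(X)$. $\bigsqcup$ (or $\sqcup$) denotes a union of disjoint sets. A solid partition of $X$ is a finite disjoint collection $\{A_i\}_{i\in I}$ of nonempty sets in $\mathscr{A}_s(X)$ with $X=\bigsqcup_{i\in I}A_i$. With $I'=\{i\in I:A_i\in\mathscr{C}_s(X)\}$, it is irreducible if $X\setminus\bigsqcup_{i\in J}A_i$ is connected for every proper subset $J\subset I'$. A set function $\lambda:\mathscr{A}_s(X)\to\mathbb{R}$ is a solid-set function if: (1) $\sum_{i\in I}\lambda(A_i)\le\lambda(X)$ for every disjoint finite collection $\{A_i\}_{i\in I}\subseteq\mathscr{A}_s(X)$; (2) $\lambda(U)=\sup\{\lambda(C):C\in\mathscr{C}_s(X),\ C\subseteq U\}$ for $U\in\mathscr{O}_s(X)$; (3) $\sum_{i\in I}\lambda(A_i)=\lambda(X)$ for every irreducible partition $X=\bigsqcup_{i\in I}A_i$; in particular $\lambda(A)+\lambda(X\setminus A)=\lambda(X)$ for every $A\in\mathscr{A}_s(X)$.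 A (real-valued) topological measure on the compact space $X$ is a set function $\mu:\mathscr{O}(X)\cup\mathscr{C}(X)\to[0,\infty)$ such that $\mu(A\sqcup B)=\mu(A)+\mu(B)$ whenever $A,B,A\sqcup B\in\mathscr{O}(X)\cup\mathscr{C}(X)$, and $\mu(U)=\sup\{\mu(C):C\in\mathscr{C}(X),\ C\subseteq U\}$ for $U\in\mathscr{O}(X)$. *)

(* Defs.v *)
From HB Require Import structures.
From mathcomp Require Import all_boot all_order all_algebra.
From mathcomp Require Import all_classical all_reals all_analysis.

Set Implicit Arguments.
Unset Strict Implicit.
Unset Printing Implicit Defensive.
Import Order.TTheory GRing.Theory Num.Theory.
Local Open Scope classical_set_scope.
Local Open Scope ring_scope.

(* Set functions on a family of subsets of X are total functions set X -> R;
   only their values on the relevant family (open or closed sets, solid sets)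
   are ever constrained or compared. *)

Definition locally_connected (X : topologicalType) :=
  forall (x : X) (U : set X), nbhs x U ->
    exists V : set X, [/\ open V, connected V, V x & V `<=` U].

Definition open_or_closed (X : topologicalType) (A : set X) :=
  open A \/ closed A.

(* The library's connected holds of set0. *)
Definition solid (X : topologicalType) (A : set X) :=
  connected A /\ connected (~` A).

Definition open_solid (X : topologicalType) (A : set X) := open A /\ solid A.

Definition closed_solid (X : topologicalType) (A : set X) :=
  closed A /\ solid A.

Definition open_or_closed_solid (X : topologicalType) (A : set X) :=
  open_solid A \/ closed_solid A.

Definition solid_partition (X : topologicalType) (I : finType)
    (A : I -> set X) :=
  [/\ forall i, open_or_closed_solid (A i),
      forall i, A i !=set0,
      trivIset setT A
    & \bigcup_i A i = setT].

Definition irreducible_partition (X : topologicalType) (I : finType)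
    (A : I -> set X) :=
  solid_partition A /\
  forall J : set I, J `<` [set i | closed_solid (A i)] ->
    connected (~` \bigcup_(i in J) A i).

(* Suprema are taken in \bar R, so that no boundedness is presupposed.
   In the last two clauses, complementary additivity follows from additivity
   on irreducible partitions for A != set0, setT; for these two sets it says
   lam set0 = 0, which partitions into nonempty sets do not give. *)
Definition solid_set_function (R : realType) (X : topologicalType)
    (lam : set X -> R) :=
  [/\ forall (I : finType) (A : I -> set X),
        (forall i, open_or_closed_solid (A i)) -> trivIset setT A ->
        \sum_i lam (A i) <= lam setT,
      forall U, open_solid U ->
        (lam U)%:E =
        ereal_sup [set (lam C)%:E | C in [set C | closed_solid C /\ C `<=` U]],
      forall (I : finType) (A : I -> set X),
        irreducible_partition A -> \sum_i lam (A i) = lam setT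
    & forall A, open_or_closed_solid A -> lam A + lam (~` A) = lam setT].

Definition topological_measure (R : realType) (X : topologicalType)
    (mu : set X -> R) :=
  [/\ forall A, open_or_closed A -> 0 <= mu A,
      forall A B, open_or_closed A -> open_or_closed B ->
        open_or_closed (A `|` B) -> A `&` B = set0 ->
        mu (A `|` B) = mu A + mu B
    & forall U, open U ->
        (mu U)%:E =
        ereal_sup [set (mu C)%:E | C in [set C | closed C /\ C `<=` U]]].

Definition extends_solid (R : realType) (X : topologicalType)
    (lam mu : set X -> R) :=
  forall A, open_or_closed_solid A -> mu A = lam A.

(* Main.v *)
Require Import Defs.
From HB Require Import structures.
From mathcomp Require Import all_boot all_order all_algebra.
From mathcomp Require Import all_classical all_reals all_analysis.
From mathcomp Require Import finmap lra.
Set Implicit Arguments.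
Unset Strict Implicit.
Unset Printing Implicit Defensive.
Import Order.TTheory GRing.Theory Num.Theory.
Local Open Scope classical_set_scope.
Local Open Scope ring_scope.

(** A topological measure [nu] that extends [lam] is forced. The components of
    the complement of a closed connected set [C] are open solid sets, and by
    inner regularity [nu (~` C)] is the sum of their measures, so that [nu C]
    is what they leave of [lam setT] ([lam_conn]). Between a closed set and an
    open set around it there is a finite disjoint union of continua
    ([continua_between]), so the measure of an open set is the supremum of the
    sums of [lam_conn] over the finite disjoint families of continua inside it
    ([open_mass]). Closed sets follow by complementation.

    Existence means that these formulas are additive. The heart of the matter
    is conservation of mass ([total_mass_eq]): for finitely many disjoint
    continua, the values [lam_conn] of the continua and the [open_mass] of the
    complement of their union add up to [lam setT]. Arbitrary disjoint closed
    sets are then squeezed between finite unions of continua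
    ([open_mass_setCU]); the other cases of additivity follow by complementation
    from this one and from the additivity of [open_mass] on open sets.

    Conservation of mass is proved by induction on the family. If [U] is an
    open solid set that is a union of components of the complement of some
    members outside it, then replacing the members outside [U] by the single
    set [~` U] gives one family, dropping the members inside [U] gives another,
    and their total masses determine that of the whole ([total_mass_cut]). Cutting along components of complements of single
    members reduces everything to singletons and to families of solid sets
    ([family_ind]). For disjoint solid sets, the total mass is at most
    [lam setT] by the first axiom of solid-set functions
    ([total_mass_solid_le]). For the converse inequality there are two cases.
    If the complement is connected, the second axiom gives arbitrarily tight
    open solid neighbourhoods of the members, and a continuum in the complement
    that covers everything outside these neighbourhoods has nearly the required
    mass ([total_mass_ge_connected]). If the complement is disconnected, a
    minimal disconnecting subfamily and the finitely many components of its
    complement form an irreducible partition, to which the third axiom applies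
    ([total_mass_ge_irreducible]); the remaining members lie in these components
    and are split off by a cut ([total_mass_ge]). *)

(** * Finite disjoint families *)

Definition cup {X : topologicalType} (s : seq (set X)) : set X :=
  \bigcup_(A in [set` s]) A.

Definition disjoint_seq {X : topologicalType} (s : seq (set X)) : bool :=
  pairwise (fun A B => A `&` B == set0) s.

Arguments disjoint_seq {X} s : simpl never.

Section families.
Context {X : topologicalType}.
Implicit Types (A B : set X) (s t : seq (set X)).

Lemma meets_not_disjoint A B x : A `&` B = set0 -> A x -> B x -> False.
Proof. by move=> AB Ax Bx; have : (A `&` B) x by []; rewrite AB. Qed.

Lemma cup_nil : cup [::] = set0 :> set X.
Proof. by rewrite /cup set_nil bigcup_set0. Qed.

Lemma cup_cons A s : cup (A :: s) = A `|` cup s.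
Proof.
apply/seteqP; split=> [x [B /=]|x [Ax|[B /= Bs Bx]]].
- by rewrite inE => /orP[/eqP->|Bs Bx]; [left|right; exists B].
- by exists A => //=; rewrite mem_head.
- by exists B => //=; rewrite inE Bs orbT.
Qed.

Lemma cup_seq1 A : cup [:: A] = A.
Proof. by rewrite cup_cons cup_nil setU0. Qed.

Lemma cup_cat s t : cup (s ++ t) = cup s `|` cup t.
Proof.
elim: s => [|A s IHs] /=; first by rewrite cup_nil set0U.
by rewrite !cup_cons IHs setUA.
Qed.

Lemma sub_cup A s : A \in s -> A `<=` cup s.
Proof. by move=> As x Ax; exists A. Qed.

Lemma cup_sub s A : (forall B, B \in s -> B `<=` A) -> cup s `<=` A.
Proof. by move=> sA x [B /= /sA]; exact. Qed.

Lemma cup_subset s t : {subset s <= t} -> cup s `<=` cup t.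
Proof. by move=> st; apply: cup_sub => B /st; exact: sub_cup. Qed.

Lemma eq_mem_cup s t : s =i t -> cup s = cup t.
Proof.
by move=> st; apply/seteqP; split; apply: cup_subset => A; rewrite st.
Qed.

Lemma disjoint_cons A s :
  disjoint_seq (A :: s) = (A `&` cup s == set0) && disjoint_seq s.
Proof.
rewrite /disjoint_seq pairwise_cons; congr (_ && _).
apply/allP/eqP => [As|As B Bs /=].
  rewrite -subset0 => x [Ax [B /= Bs Bx]].
  by have /eqP/meets_not_disjoint := As B Bs; apply; [exact: Ax|].
by apply/eqP; rewrite -subset0 -As => x [Ax Bx]; split=> //; exists B.
Qed.

Lemma setU_eq0b A B : (A `|` B == set0) = (A == set0) && (B == set0).
Proof.
apply/eqP/andP => [|[/eqP-> /eqP->]]; last by rewrite setU0.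
by rewrite setU_eq0 => -[-> ->].
Qed.

Lemma disjoint_cat s t : disjoint_seq (s ++ t) =
  [&& cup s `&` cup t == set0, disjoint_seq s & disjoint_seq t].
Proof.
elim: s => [|A s IHs]; first by rewrite cup_nil set0I eqxx.
rewrite cat_cons !disjoint_cons IHs !cup_cons cup_cat setIUr setIUl !setU_eq0b.
case: (A `&` cup s == _); case: (A `&` cup t == _) => //=.
all: by rewrite ?andbF ?andbT.
Qed.

Lemma disjoint_perm s t : perm_eq s t -> disjoint_seq s = disjoint_seq t.
Proof.
move: s t; apply: catCA_perm_subst => s1 s2 s3.
rewrite !disjoint_cat !cup_cat !setIUr !setU_eq0b (setIC (cup s2) (cup s1)).
case: (cup s1 `&` cup s2 == _); case: (cup s1 `&` cup s3 == _);
  case: (cup s2 `&` cup s3 == _); case: (disjoint_seq s1);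
  by case: (disjoint_seq s2).
Qed.

Lemma disjoint_filter (p : pred (set X)) s :
  disjoint_seq s -> disjoint_seq [seq A <- s | p A].
Proof. exact: pairwise_filter. Qed.

Lemma disjoint_map (f : set X -> set X) s : uniq s ->
  (forall A B, A \in s -> B \in s -> A != B -> f A `&` f B = set0) ->
  disjoint_seq (map f s).
Proof.
elim: s => [//|A s IHs] /= /andP[As us] dj; rewrite disjoint_cons IHs//.
  rewrite andbT; apply/eqP; rewrite -subset0 => x [Ax [_ /mapP[B Bs ->] Bx]].
  suff AB0 : f A `&` f B = set0 by exact: (meets_not_disjoint AB0 Ax Bx).
  apply: dj; rewrite ?mem_head ?inE ?Bs ?orbT//.
  by apply: contraNneq As => ->.
by move=> B C Bs Cs; apply: dj; rewrite inE ?Bs ?Cs orbT.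
Qed.

Lemma disjoint_uniq s : uniq s ->
  (forall A B, A \in s -> B \in s -> A != B -> A `&` B = set0) ->
  disjoint_seq s.
Proof. by move=> us dj; rewrite -[s]map_id; exact: disjoint_map. Qed.

Lemma uniq_disjoint s : disjoint_seq s -> (forall A, A \in s -> A !=set0) ->
  uniq s.
Proof.
elim: s => [//|A s IHs]; rewrite disjoint_cons => /andP[/eqP As djs] s0 /=.
rewrite IHs//; last by move=> B Bs; apply: s0; rewrite inE Bs orbT.
rewrite andbT; apply/negP => Ain; have [x Ax] := s0 A (mem_head _ _).
by apply: (meets_not_disjoint As Ax); exists A.
Qed.

Lemma disjoint_mem s A B : disjoint_seq s -> A \in s -> B \in s -> A != B ->
  A `&` B = set0.
Proof.
elim: s => [//|C s IHs]; rewrite disjoint_cons => /andP[/eqP C0 ds].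
rewrite !inE => /orP[/eqP->|As] /orP[/eqP->|Bs]; rewrite ?eqxx// => AB.
- by rewrite -subset0 -C0; apply: setIS; exact: sub_cup.
- by rewrite -subset0 -C0 setIC; apply: setIS; exact: sub_cup.
- exact: IHs.
Qed.

Lemma closed_cup s : (forall A, A \in s -> closed A) -> closed (cup s).
Proof.
elim: s => [|A s IHs] sc; first by rewrite cup_nil; exact: closed0.
rewrite cup_cons; apply: closedU; first by apply: sc; exact: mem_head.
by apply: IHs => B Bs; apply: sc; rewrite inE Bs orbT.
Qed.

Lemma open_cup s : (forall A, A \in s -> open A) -> open (cup s).
Proof. by move=> so; apply: bigcup_open => A /= /so. Qed.

End families.

(** * Connectedness *)

Section topology.
Context {X : topologicalType}.
Implicit Types (A B C G K U V W : set X) (s t : seq (set X)).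

Lemma compact_finite_subcover K (F : set (set X)) :
  compact K -> (forall U, F U -> open U) -> K `<=` \bigcup_(U in F) U ->
  exists2 s : seq (set X), forall U, U \in s -> F U & K `<=` cup s.
Proof.
move=> cK oF KF.
have [->|/set0P[x0 _]] := eqVneq K set0; first by exists [::].
(* [x0] makes [X] a pointed space, as [compact_cover] requires *)
pose Y : ptopologicalType := HB.pack X (isPointed.Build X x0).
have cKY : @cover_compact Y K by rewrite -(@compact_cover Y).
have [D DF KD] := cKY _ F idfun oF KF.
exists (enum_fset D) => [U UD|x /KD[U UD Ux]]; last by exists U.
exact: set_mem (DF _ UD).
Qed.

Lemma connected_sub_openU A U V : connected A -> open U -> open V ->
  U `&` V = set0 -> A `<=` U `|` V -> A `<=` U \/ A `<=` V.
Proof.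
move=> cA oU oV UV AUV; apply: connected_subset cA => //.
have cl B C : open C -> B `&` C = set0 -> closure B `&` C = set0.
  move=> oC BC; apply/disjoints_subset.
  have /closure_id-> : closed (~` C) by exact: open_closedC.
  by apply: closureS; exact/disjoints_subset.
by split; [exact: cl|rewrite setIC; apply: cl; rewrite // setIC].
Qed.

Lemma connected_touch A B : connected A -> connected B ->
  closure A `&` B !=set0 -> connected (A `|` B).
Proof.
move=> cA cB [x [Ax Bx]]; apply/connectedP => E [E0 AB sE].
have disE : E false `&` E true = set0 by exact: separated_disjoint.
have sub C : connected C -> C `<=` A `|` B ->
    exists b, C `<=` E b /\ C `&` E (~~ b) = set0.
  rewrite AB => cC CE; have [CE'|CE'] := connected_subset sE CE cC.
    by exists false; split=> //; rewrite -subset0 -disE; exact: setSI.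
  by exists true; split=> //; rewrite -subset0 -disE setIC; exact: setIS.
have [b [Ab _]] := sub A cA (@subsetUl _ _ _).
have [c [Bc _]] := sub B cB (@subsetUr _ _ _).
have [bc|bc] := eqVneq b c.
  rewrite -bc in Bc.
  have [y Ey] := E0 (~~ b).
  have Ey' : E b y.
    suff : (A `|` B) y by case=> [/Ab|/Bc].
    by rewrite AB; case: (b) Ey; [left|right].
  move: Ey Ey'; case: (b) => /= Ey Ey'.
    exact: meets_not_disjoint disE Ey Ey'.
  exact: meets_not_disjoint disE Ey' Ey.
have cx : E c x by exact: Bc.
have bx : closure (E b) x by exact: closureS Ax.
move: sE bc cx bx => [s1 s2]; case: (b); case: (c) => // _ cx bx.
  exact: meets_not_disjoint s2 cx bx.
exact: meets_not_disjoint s1 bx cx.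
Qed.

Lemma connected_clopen A G : connected G -> A !=set0 -> A `<=` G -> open A ->
  closure A `&` G `<=` A -> A = G.
Proof.
move=> cG A0 AG oA clA; apply: cG => //.
  by exists A => //; apply/esym/setIidPr.
exists (closure A); first exact: closed_closure.
apply/seteqP; split=> [x Ax|x [Gx Ax]]; last exact: clA.
by split; [exact: AG|exact: subset_closure].
Qed.

Lemma not_connected_two_closed A B : connected [set: X] -> closed A ->
  closed B -> A !=set0 -> B !=set0 -> A `&` B = set0 ->
  ~` (A `|` B) !=set0.
Proof.
move=> cX clA clB A0 [y By] AB; apply/set0P/negP => /eqP N0.
have AT : A = setT.
  apply: (connected_clopen cX) => //; last first.
    by rewrite setIT -(closure_id A).1.
  suff -> : A = ~` B by exact: closed_openC clB.
  apply/seteqP; split=> [x Ax Bx|x Bx].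
    exact: meets_not_disjoint AB Ax Bx.
  apply: contrapT => Ax; have : (~` (A `|` B)) x by case=> [/Ax|/Bx].
  by rewrite N0.
by apply: (meets_not_disjoint AB _ By); rewrite AT.
Qed.

End topology.

(** * Components of open sets *)

Section components.
Context {X : topologicalType}.
Hypothesis Xconnected : connected [set: X].
Hypothesis Xlocconn : locally_connected X.
Implicit Types (A B C G K U V W : set X) (s t : seq (set X)) (x y : X).

Lemma open_component G x : open G -> open (connected_component G x).
Proof.
move=> oG; rewrite openE => y Cy.
have Gy : G y by exact: connected_component_sub Cy.
have [V [oV cV Vy VG]] := Xlocconn (open_nbhs_nbhs (conj oG Gy)).
apply: (@filterS _ (nbhs y) _ V); last exact: open_nbhs_nbhs.
rewrite (same_connected_component Cy) => z Vz.
exact: (connected_component_max Vy VG cV).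
Qed.

Lemma component_dichotomy G x A : connected A -> A `<=` G ->
  A `<=` connected_component G x \/ A `&` connected_component G x = set0.
Proof.
move=> cA AG; have [[y [Ay Cy]]|] := pselect (A `&` connected_component G x !=set0).
  left; rewrite (same_connected_component Cy).
  exact: connected_component_max.
by move=> /set0P/negP; rewrite negbK => /eqP; right.
Qed.

Lemma open_setD_component G x : open G ->
  open (G `\` connected_component G x).
Proof.
move=> oG.
have -> : G `\` connected_component G x =
    \bigcup_(y in G `\` connected_component G x) connected_component G y.
  apply/seteqP; split=> [y Gy|z [y [Gy nCy] Cz]].
    by exists y => //; apply: connected_component_refl; case: Gy.
  split; first exact: connected_component_sub Cz.
  move=> Cz'; apply: nCy; apply: connected_component_trans Cz' _.
  exact: connected_component_sym.
by apply: bigcup_open => y _; exact: open_component.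
Qed.

Lemma closed_component_setC G x : open G ->
  closed (connected_component G x `|` ~` G).
Proof.
move=> oG; rewrite -openC setCU setCK setIC -setDE.
exact: open_setD_component.
Qed.

Lemma closure_component G x : open G ->
  closure (connected_component G x) `<=` connected_component G x `|` ~` G.
Proof.
move=> oG; rewrite [X in _ `<=` X](closure_id _).1.
  by apply: closureS; exact: subsetUl.
exact: closed_component_setC.
Qed.

(** A component that touched no point of the complement would be clopen. *)
Lemma component_touch_setC G x : open G -> G x -> ~` G !=set0 ->
  closure (connected_component G x) `&` ~` G !=set0.
Proof.
move=> oG Gx [z Gz]; apply/set0P/negP => /eqP CG.
have CT : connected_component G x = setT.
  apply: (connected_clopen Xconnected) => //.
  - by exists x; exact: connected_component_refl.
  - exact: open_component.
  - rewrite setIT => y Cy; have [//|Gy] := closure_component oG Cy.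
    by case: (meets_not_disjoint CG Cy Gy).
by apply: Gz; apply: (@connected_component_sub _ G x); rewrite CT.
Qed.

(** Every component of [~` A] touches [A], so [A] together with any family of
    these components stays connected. *)
Lemma connected_setC_component A x : closed A -> connected A -> A !=set0 ->
  connected (~` connected_component (~` A) x).
Proof.
move=> clA cA [a Aa]; set C := connected_component _ x.
have oA : open (~` A) by exact: closed_openC.
have -> : ~` C = \bigcup_(y in ~` C) (connected_component (~` A) y `|` A).
  apply/seteqP; split=> [y Cy|z [y Cy [Cz|Az]]].
  - exists y => //; have [Ay|Ay] := pselect (A y); first by right.
    by left; exact: connected_component_refl.
  - move=> Cz'; apply: Cy; apply: connected_component_trans Cz' _.
    exact: connected_component_sym.
  - by move=> /connected_component_sub.
apply: bigcup_connected; first by exists a => y _; right.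
move=> y _; have [Ay|Ay] := pselect (A y).
  rewrite connected_component_out ?set0U//; exact.
apply: connected_touch => //; first exact: component_connected.
by rewrite -[X in _ `&` X]setCK; apply: component_touch_setC; rewrite ?setCK//; exists a.
Qed.

Lemma finite_component_cover G K : open G -> compact K -> K `<=` G ->
  exists s, [/\ disjoint_seq s,
    forall W, W \in s -> exists2 x, G x & W = connected_component G x
    & K `<=` cup s].
Proof.
move=> oG cK KG.
pose F := [set W | exists2 x, G x & W = connected_component G x].
have [||s sF Ks] := @compact_finite_subcover _ K F cK.
- by move=> _ [x _ ->]; exact: open_component.
- move=> x /KG Gx; exists (connected_component G x); first by exists x.
  exact: connected_component_refl.
exists (undup s); split.
- apply: disjoint_uniq; first exact: undup_uniq.
  move=> A B; rewrite !mem_undup => /sF[x _ ->] /sF[y _ ->].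
  apply: contra_neqP => /eqP/set0P[z [Cx Cy]].
  by rewrite (same_connected_component Cx) -(same_connected_component Cy).
- by move=> W; rewrite mem_undup; exact: sF.
- by rewrite (eq_mem_cup (mem_undup s)).
Qed.

(** * Disconnecting families *)

(** A component [D] of the complement [G] that missed [A] would be clopen in
    the connected set [G `|` A]. *)
Lemma component_touch_member s A x : (forall B, B \in s -> closed B) ->
  disjoint_seq s -> A \in s -> A !=set0 ->
  connected (~` cup (rem A s)) -> (~` cup s) x ->
  closure (connected_component (~` cup s) x) `&` A !=set0.
Proof.
move=> cls djs As [a Aa] crem Gx; set G := ~` cup s.
have oG : open G by apply: closed_openC; exact: closed_cup.
have sE : cup s = A `|` cup (rem A s).
  by rewrite -cup_cons; apply: eq_mem_cup; apply: perm_mem; exact: perm_to_rem.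
have djA : A `&` cup (rem A s) = set0.
  apply/eqP; move: djs; rewrite (disjoint_perm (perm_to_rem As)).
  by rewrite disjoint_cons => /andP[].
apply/set0P/negP => /eqP DA.
have : connected_component G x a.
  rewrite (connected_clopen crem (A := connected_component G x)).
  - by move=> ra; exact: meets_not_disjoint djA Aa ra.
  - by exists x; exact: connected_component_refl.
  - move=> y /connected_component_sub; rewrite /G sE => Gy ry.
    by apply: Gy; right.
  - exact: open_component.
  - move=> y [Dy ry]; have [//|] := closure_component oG Dy.
    rewrite /G setCK sE => -[Ay|//].
    by case: (meets_not_disjoint DA Dy Ay).
by move=> /connected_component_sub; apply; exists A.
Qed.

(** Each component touches every member of [s], so the members of [s] and one
    component other than the removed one form a connected set, to which all the
    remaining components attach. *)
Lemma connected_setC_component_family s x : (forall B, B \in s -> closed B) ->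
  (forall B, B \in s -> connected B) -> (forall B, B \in s -> B !=set0) ->
  disjoint_seq s -> (forall A, A \in s -> connected (~` cup (rem A s))) ->
  s != [::] -> ~ connected (~` cup s) -> (~` cup s) x ->
  connected (~` connected_component (~` cup s) x).
Proof.
move=> cls cs s0 djs crem sn0 ncG Gx; set G := ~` cup s.
have oG : open G by apply: closed_openC; exact: closed_cup.
set D := connected_component G x.
have touch A y : A \in s -> G y ->
    closure (connected_component G y) `&` A !=set0.
  by move=> As Gy; apply: component_touch_member => //; [exact: s0|exact: crem].
have [y [Gy nDy]] : exists y, G y /\ ~ D y.
  apply: contrapT => noy; apply: ncG; rewrite -/G.
  suff <- : D = G by exact: component_connected.
  apply/seteqP; split=> [|y Gy]; first exact: connected_component_sub.
  by apply: contrapT => nDy; apply: noy; exists y.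
set E := connected_component G y.
have DE : D `&` E = set0.
  rewrite -subset0 => z [Dz Ez]; apply: nDy; apply: connected_component_trans Dz _.
  exact: connected_component_sym.
have cN : connected (E `|` cup s).
  have -> : E `|` cup s = \bigcup_(A in [set` s]) (E `|` A).
    apply/seteqP; split=> [z [Ez|[A As Az]]|z [A As [Ez|Az]]].
    - case: s sn0 {cls cs s0 djs crem ncG Gx oG touch} @G @D Gy nDy @E DE Ez.
        by [].
      move=> A s _ G D Gy nDy E DE Ez; exists A; last by left.
      by rewrite /= mem_head.
    - by exists A => //; right.
    - by left.
    - by right; exists A.
  apply: bigcup_connected.
    by exists y => A _; left; exact: connected_component_refl.
  move=> A As; apply: connected_touch; first exact: component_connected.
    exact: cs.
  exact: touch.
have -> : ~` D = \bigcup_(z in ~` D) (connected_component G z `|` (E `|` cup s)).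
  apply/seteqP; split=> [z Dz|z [w Dw [Cz|[Ez|sz]]]].
  - exists z => //; have [Gz|/contrapT sz] := pselect (G z).
      by left; exact: connected_component_refl.
    by right; right.
  - move=> Dz; apply: Dw; apply: connected_component_trans Dz _.
    exact: connected_component_sym.
  - by move=> Dz; exact: meets_not_disjoint DE Dz Ez.
  - by move=> /connected_component_sub; apply.
apply: bigcup_connected.
  by exists y => A _; right; left; exact: connected_component_refl.
move=> z _; have [Gz|Gz] := pselect (G z); last first.
  by rewrite connected_component_out ?set0U.
apply: connected_touch => //; first exact: component_connected.
have [A As] : exists A, A \in s.
  by case: (s) sn0 => // A t _; exists A; rewrite mem_head.
have [w [Cw Aw]] := touch A z As Gz.
by exists w; split=> //; right; exists A.
Qed.

End components.

(** * Compact Hausdorff spaces *)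

Section compact_hausdorff.
Context {X : topologicalType}.
Hypothesis Xcompact : compact [set: X].
Hypothesis Xhausdorff : hausdorff_space X.
Hypothesis Xconnected : connected [set: X].
Hypothesis Xlocconn : locally_connected X.
Implicit Types (A B C G K U V W : set X) (s t : seq (set X)) (x y : X).

Lemma closed_compact K : closed K -> compact K.
Proof. by move=> cK; exact: subclosed_compact cK Xcompact _. Qed.

Lemma closed_shrink A U : closed A -> open U -> A `<=` U ->
  exists V, [/\ open V, A `<=` V & closure V `<=` U].
Proof.
move=> cA oU AU.
have [|V /set_nbhsP[W [oW AW WV]] VU] := compact_normal Xhausdorff Xcompact cA (t := U).
  by apply/set_nbhsP; exists U; split=> //; exact: subset_refl.
by exists W; split=> //; apply: subset_trans VU; exact: closureS.
Qed.

Lemma nbhs_connected_closure x U : open U -> U x ->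
  exists V, [/\ open V, connected V, V x & closure V `<=` U].
Proof.
move=> oU Ux; have cx : closed [set x].
  by apply: accessible_closed_set1; exact: hausdorff_accessible.
have [|V [oV xV VU]] := closed_shrink cx oU; first by move=> _ ->.
have Vx : V x by exact: xV.
have [W [oW cW Wx WV]] := Xlocconn (open_nbhs_nbhs (conj oV Vx)).
by exists W; split=> //; apply: subset_trans VU; exact: closureS.
Qed.

(** A component of the complement touches two of the members, hence meets the
    boundary of a suitable neighbourhood of one of them; that boundary is a
    compact subset of the open complement. *)
Lemma finite_components_family s : (forall B, B \in s -> closed B) ->
  (forall B, B \in s -> B !=set0) ->
  disjoint_seq s -> (forall A, A \in s -> connected (~` cup (rem A s))) ->
  (1 < size s)%N ->
  exists t, [/\ disjoint_seq t,
    forall W, W \in t ->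
      exists2 x, (~` cup s) x & W = connected_component (~` cup s) x
    & cup t = ~` cup s].
Proof.
move=> cls s0 djs crem; case sE : s => [//|A [//|B s']] _.
rewrite -sE; set G := ~` cup s.
have As : A \in s by rewrite sE mem_head.
have Bs : B \in s by rewrite sE !inE eqxx orbT.
have oG : open G by apply: closed_openC; exact: closed_cup.
have remE : rem A s = B :: s' by rewrite sE /= eqxx.
have Brem : B `<=` cup (rem A s) by rewrite remE; apply: sub_cup; exact: mem_head.
have clrem : closed (cup (rem A s)).
  by apply: closed_cup => C /mem_rem; exact: cls.
have djA : A `&` cup (rem A s) = set0.
  apply/eqP; move: djs; rewrite (disjoint_perm (perm_to_rem As)).
  by rewrite disjoint_cons => /andP[].
have [||O [oO AO OR]] := @closed_shrink A (~` cup (rem A s)) (cls _ As).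
- exact: closed_openC.
- exact/disjoints_subset.
have KG : closure O `&` ~` O `<=` G.
  move=> z [clOz Oz]; rewrite /G (eq_mem_cup (perm_mem (perm_to_rem As))).
  by rewrite cup_cons => -[/AO //|]; exact: OR.
have [|t [djt tc Kt]] := @finite_component_cover _ Xlocconn G _ oG _ KG.
  by apply: closed_compact; apply: closedI; [exact: closed_closure|exact: open_closedC].
exists t; split=> //; apply/seteqP; split=> [z [W /= /tc[x _ ->]]|y Gy].
  exact: connected_component_sub.
set D := connected_component G y.
have oD : open D by exact: open_component.
have meet C V : C \in s -> open V -> C `<=` V -> D `&` V !=set0.
  move=> Cs oV CV.
  have [z [clDz Cz]] := component_touch_member Xlocconn cls djs Cs (s0 _ Cs) (crem _ Cs) Gy.
  exact: clDz (open_nbhs_nbhs (conj oV (CV _ Cz))).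
suff [z [Dz clOz Oz]] : exists z, [/\ D z, closure O z & ~ O z].
  have [W Wt Wz] := Kt _ (conj clOz Oz).
  exists W => //; have [x _ Wx] := tc _ Wt; rewrite Wx in Wz *.
  apply: connected_component_trans Wz _; exact: connected_component_sym.
apply: contrapT => noz.
have [u [Du Ou]] := meet A O As oO AO.
have [|v [Dv Ov]] := meet B (~` closure O) Bs (closed_openC (@closed_closure _ O)).
  by move=> z /Brem rz Oz; exact: OR rz.
have [||||DO|DO] := @connected_sub_openU _ D O (~` closure O) _ oO.
- exact: component_connected.
- exact/closed_openC/closed_closure.
- by apply/disjoints_subset; rewrite setCK; exact: subset_closure.
- move=> z Dz; have [Oz|Oz] := pselect (O z); first by left.
  by right=> clOz; apply: noz; exists z.
- by apply: Ov; apply: subset_closure; exact: DO.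
- by apply: (DO _ Du); exact: subset_closure.
Qed.

(** The points reached from [x] inside [G] by closed connected sets form a
    clopen subset of [G]. *)
Lemma connected_open_exhaust G K x : open G -> connected G -> G x ->
  closed K -> K `<=` G ->
  exists E, [/\ closed E, connected E, E x, K `<=` E & E `<=` G].
Proof.
move=> oG cG Gx clK KG.
pose P E := [/\ closed E, connected E, E x & E `<=` G].
pose S := \bigcup_(E in P) E°.
have PU E V : P E -> open V -> connected V -> closure V `<=` G ->
    E `&` V !=set0 -> P (E `|` closure V).
  move=> [clE cE Ex EG] oV cV VG [z [Ez Vz]]; split.
  - by apply: closedU => //; exact: closed_closure.
  - apply: connectedU => //; last exact: connected_closure.
    by exists z; split=> //; exact: subset_closure.
  - by left.
  - by rewrite subUset.
have sub_int E V : open V -> V `<=` (E `|` closure V)°.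
  move=> oV; rewrite -open_subsetE//.
  by apply: subset_trans (@subsetUr _ _ _); exact: subset_closure.
have SG : S = G.
  apply: connected_clopen => //.
  - have [V [oV cV Vx VG]] := nbhs_connected_closure oG Gx.
    exists x, ([set x] `|` closure V); last exact: sub_int.
    apply: PU => //; last by exists x.
    split=> //; last by move=> _ ->.
      by apply: accessible_closed_set1; exact: hausdorff_accessible.
    exact: connected1.
  - by move=> y [E [_ _ _ EG] /interior_subset/EG].
  - by apply: bigcup_open => E _; exact: open_interior.
  - move=> y [clSy Gy].
    have [V [oV cV Vy VG]] := nbhs_connected_closure oG Gy.
    have [z [[E PE Ez] Vz]] := clSy V (open_nbhs_nbhs (conj oV Vy)).
    exists (E `|` closure V); last exact: sub_int.
    apply: PU => //; exists z; split=> //; exact: interior_subset.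
have [|||s sP Ks] := @compact_finite_subcover _ K [set E° | E in P].
- exact: closed_compact.
- by move=> _ [E _ <-]; exact: open_interior.
- move=> y /KG; rewrite -SG => -[E PE Ey]; exists E° => //.
  by exists E.
suff [E PE sE] : exists2 E, P E & cup s `<=` E.
  by exists E; case: PE => ? ? ? ?; split=> //; exact: subset_trans sE.
elim: s sP {Ks} => [|A s IHs] sP.
  exists [set x]; last by rewrite cup_nil.
  split=> //; last by move=> _ ->.
    by apply: accessible_closed_set1; exact: hausdorff_accessible.
  exact: connected1.
have [|E [clE cE Ex EG] sE] := IHs.
  by move=> B Bs; apply: sP; rewrite inE Bs orbT.
have [F [clF cF Fx FG] FA] := sP A (mem_head _ _).
exists (E `|` F).
  split; [exact: closedU| |by left|by rewrite subUset].
  by apply: connectedU => //; exists x.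
rewrite cup_cons -FA subUset; split.
  by apply: subset_trans (@subsetUr _ _ _); exact: interior_subset.
exact: subset_trans sE (@subsetUl _ _ _).
Qed.

Definition continuum A := [/\ closed A, connected A & A !=set0].

(** Members that meet are merged into one. *)
Lemma merge_continua s : (forall A, A \in s -> continuum A) ->
  exists t, [/\ disjoint_seq t, forall A, A \in t -> continuum A
    & cup t = cup s].
Proof.
elim: s => [|A s IHs] sc; first by exists [::].
have [|t [djt tc ts]] := IHs; first by move=> B Bs; apply: sc; rewrite inE Bs orbT.
have [clA cA A0] := sc A (mem_head _ _).
pose m := [pred B | (A `&` B) != set0].
exists ((A `|` cup [seq B <- t | m B]) :: [seq B <- t | ~~ m B]).
have tE : cup t = cup [seq B <- t | m B] `|` cup [seq B <- t | ~~ m B].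
  rewrite -cup_cat; apply: eq_mem_cup => B; rewrite mem_cat !mem_filter -andb_orl.
  by rewrite orbN.
split.
- rewrite disjoint_cons disjoint_filter// andbT.
  move: djt; rewrite -(disjoint_perm (permEl (perm_filterC m t))).
  rewrite disjoint_cat => /and3P[/eqP dj _ _].
  rewrite setIUl dj setU0; apply/eqP; rewrite -subset0 => x [Ax [B]].
  rewrite /= mem_filter negbK => /andP[/eqP AB _] Bx.
  exact: meets_not_disjoint AB Ax Bx.
- move=> B; rewrite inE => /orP[/eqP->|]; last first.
    by rewrite mem_filter => /andP[_]; exact: tc.
  split.
  + apply: closedU => //; apply: closed_cup => C; rewrite mem_filter.
    by move=> /andP[_ /tc[]].
  + have -> : A `|` cup [seq B <- t | m B] =
        \bigcup_(C in [set` A :: [seq B <- t | m B]]) (A `|` C).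
      apply/seteqP; split=> [x [Ax|[C Cs Cx]]|x [C /=]].
      * by exists A; [rewrite /= mem_head|left].
      * by exists C; [rewrite /= inE Cs orbT|right].
      * rewrite inE => /orP[/eqP-> [Ax|Ax]|Cs [Ax|Cx]]; try by left.
        by right; exists C.
    apply: bigcup_connected.
      by case: A0 => a Aa; exists a => C _; left.
    move=> C /=; rewrite inE => /orP[/eqP->|]; first by rewrite setUid.
    rewrite mem_filter => /andP[/set0P AC /tc[_ cC _]].
    exact: connectedU.
  + by case: A0 => a Aa; exists a; left.
- by rewrite cup_cons -setUA -tE ts -cup_cons.
Qed.

Lemma continua_between K U : closed K -> open U -> K `<=` U ->
  exists s, [/\ disjoint_seq s, forall A, A \in s -> continuum A,
    K `<=` cup s & cup s `<=` U].
Proof.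
move=> clK oU KU.
pose F := [set V : set X | [/\ open V, connected V, V !=set0 & closure V `<=` U]].
have [||s sF Ks] := @compact_finite_subcover _ K F (closed_compact clK).
- by move=> V [].
- move=> x /KU Ux; have [V [oV cV Vx VU]] := nbhs_connected_closure oU Ux.
  by exists V => //; split=> //; exists x.
have [|t [djt tc tE]] := @merge_continua (map closure s).
  move=> _ /mapP[V /sF[_ cV [x Vx] _] ->]; split.
  - exact: closed_closure.
  - exact: connected_closure.
  - by exists x; exact: subset_closure.
exists t; split=> //; rewrite tE.
  move=> x /Ks[V /= Vs Vx]; exists (closure V); last exact: subset_closure.
  by rewrite /= map_f.
by apply: cup_sub => _ /mapP[V /sF[_ _ _ VU] ->].
Qed.

Lemma disjoint_open_nbhs s : (forall A, A \in s -> closed A) ->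
  disjoint_seq s -> exists f : set X -> set X,
  (forall A, A \in s -> open (f A) /\ A `<=` f A) /\
  (forall A B, A \in s -> B \in s -> A != B -> f A `&` f B = set0).
Proof.
move=> + djs; suff : forall N, open N -> cup s `<=` N ->
    (forall A, A \in s -> closed A) -> exists f : set X -> set X,
  (forall A, A \in s -> [/\ open (f A), A `<=` f A & f A `<=` N]) /\
  (forall A B, A \in s -> B \in s -> A != B -> f A `&` f B = set0).
  move=> /(_ setT openT (@subsetT _ _)) + cls => /(_ cls)[f [fN fdj]].
  by exists f; split=> // A /fN[].
elim: s djs => [|A s IHs] djs N oN sN cls; first by exists id.
move: djs; rewrite disjoint_cons => /andP[/eqP As djs].
have clA : closed A by apply: cls; exact: mem_head.
have cls' B : B \in s -> closed B by move=> Bs; apply: cls; rewrite inE Bs orbT.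
move: sN; rewrite cup_cons subUset => -[AN sN].
have [||V [oV AV VN]] := @closed_shrink A (N `&` ~` cup s) clA.
- by apply: openI => //; apply: closed_openC; exact: closed_cup.
- by move=> x Ax; split; [exact: AN|move=> sx; exact: meets_not_disjoint As Ax sx].
have [||f [fN fdj]] := IHs djs (N `&` ~` closure V) _ _ cls'.
- by apply: openI => //; exact/closed_openC/closed_closure.
- by move=> x sx; split; [exact: sN|move=> /VN[]].
exists (fun B => if B \in s then f B else V).
have VS B : B \in s -> V `&` f B = set0.
  move=> /fN[_ _ fB]; rewrite -subset0 => x [Vx /fB[_]]; apply.
  exact: subset_closure.
split=> [B|B C]; rewrite inE.
  case: ifPn => [/fN[? ? fB] _|_]; first by split=> // x /fB[].
  rewrite orbF => /eqP->; split=> // x /subset_closure/VN[]//.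
rewrite inE; case: ifPn => Bs; case: ifPn => Cs.
- by move=> _ _; exact: fdj.
- by move=> _ _ _; rewrite setIC; exact: VS.
- by move=> _ _ _; exact: VS.
- by rewrite !orbF => /eqP-> /eqP->; rewrite eqxx.
Qed.

End compact_hausdorff.

(** * Packings *)

Section packings.
Context {R : realType} {X : topologicalType}.
Implicit Types (P : set (set X)) (f : set X -> R).
Implicit Types (A B C G K U V W : set X) (s t : seq (set X)).

Definition packing P U s :=
  [/\ disjoint_seq s, forall A, A \in s -> P A & cup s `<=` U].

Definition pack P f U : R :=
  sup [set \sum_(A <- s) f A | s in packing P U].

Lemma packing_nil P U : packing P U [::].
Proof. by split=> //; rewrite cup_nil. Qed.

Lemma packingS P U V s : U `<=` V -> packing P U s -> packing P V s.
Proof. by move=> UV [? ? sU]; split=> //; exact: subset_trans UV. Qed.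

Lemma packing_filter P U V s (p : pred (set X)) : packing P U s ->
  (forall A, A \in s -> p A -> A `<=` V) -> packing P V [seq A <- s | p A].
Proof.
move=> [djs sP sU] sV; split; first exact: disjoint_filter.
  by move=> A; rewrite mem_filter => /andP[_]; exact: sP.
by apply: cup_sub => A; rewrite mem_filter => /andP[pA As]; exact: sV.
Qed.

Lemma packing_cat P U V s t : U `&` V = set0 -> packing P U s ->
  packing P V t -> packing P (U `|` V) (s ++ t).
Proof.
move=> UV [djs sP sU] [djt tP tV]; split.
- rewrite disjoint_cat djs djt !andbT; apply/eqP; rewrite -subset0 -UV.
  exact: setISS.
- by move=> A; rewrite mem_cat => /orP[]; [exact: sP|exact: tP].
- by rewrite cup_cat; exact: setUSS.
Qed.

Lemma pack_le P f U c :
  (forall s, packing P U s -> \sum_(A <- s) f A <= c) -> pack P f U <= c.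
Proof.
move=> sc; apply: ge_sup; last by move=> _ [s + <-]; exact: sc.
by exists (\sum_(A <- [::]) f A); exists [::] => //; exact: packing_nil.
Qed.

Section bounded.
Variables (P : set (set X)) (f : set X -> R) (M : R).
Hypothesis f_le : forall s, packing P setT s -> \sum_(A <- s) f A <= M.
Hypothesis P_connected : forall A, P A -> connected A.

Lemma pack_ge U s : packing P U s -> \sum_(A <- s) f A <= pack P f U.
Proof.
move=> sU; apply: ub_le_sup; last by exists s.
by exists M => _ [t tU <-]; apply: f_le; exact: packingS tU.
Qed.

Lemma pack_le_bound U : pack P f U <= M.
Proof. by apply: pack_le => s sU; apply: f_le; exact: packingS sU. Qed.

Lemma packS U V : U `<=` V -> pack P f U <= pack P f V.
Proof. by move=> UV; apply: pack_le => s sU; apply: pack_ge; exact: packingS sU. Qed.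

Lemma pack_ge0 U : 0 <= pack P f U.
Proof. by have := pack_ge (packing_nil P U); rewrite big_nil. Qed.

Lemma pack_superadditive U V : U `&` V = set0 ->
  pack P f U + pack P f V <= pack P f (U `|` V).
Proof.
move=> UV; rewrite -lerBrDr; apply: pack_le => s sU.
rewrite lerBrDl -lerBrDr; apply: pack_le => t tV.
by rewrite lerBrDr addrC -big_cat; apply: pack_ge; exact: packing_cat.
Qed.

(** Members of a packing are connected, so each lies in [U] or in [V]. *)
Lemma packU U V : open U -> open V -> U `&` V = set0 ->
  pack P f (U `|` V) = pack P f U + pack P f V.
Proof.
move=> oU oV UV; apply/eqP; rewrite eq_le pack_superadditive// andbT.
apply: pack_le => s sUV; have [djs sP sub] := sUV.
rewrite -(perm_big _ (permEl (perm_filterC (fun A => `[< A `<=` U >]) s)))/=.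
rewrite big_cat lerD//; apply: pack_ge; apply: packing_filter sUV _ => A As.
  by move/asboolP.
have AUV := subset_trans (sub_cup As) sub.
by have [/asboolP->|] := connected_sub_openU (P_connected (sP _ As)) oU oV UV AUV.
Qed.

Lemma pack0 : pack P f set0 = 0.
Proof.
have := packU open0 open0 (set0I set0); rewrite setU0 => /eqP.
by rewrite -subr_eq subrr eq_sym => /eqP.
Qed.

Lemma pack_cup s : disjoint_seq s -> (forall U, U \in s -> open U) ->
  pack P f (cup s) = \sum_(U <- s) pack P f U.
Proof.
elim: s => [|U s IHs]; first by rewrite cup_nil big_nil pack0.
rewrite disjoint_cons cup_cons big_cons => /andP[/eqP Us djs] so.
have so' V : V \in s -> open V by move=> Vs; apply: so; rewrite inE Vs orbT.
rewrite packU ?IHs//; first by apply: so; exact: mem_head.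
exact: open_cup.
Qed.

Lemma pack_setD C U : P C -> C `<=` U -> f C + pack P f (U `\` C) <= pack P f U.
Proof.
move=> PC CU.
have -> : pack P f U = pack P f (C `|` U `\` C) by rewrite setDUK.
rewrite (le_trans _ (pack_superadditive _)) ?setDIK// lerD2r.
have := @pack_ge C [:: C]; rewrite big_seq1; apply; split=> //.
  by move=> A; rewrite inE => /eqP->.
by rewrite cup_seq1.
Qed.

End bounded.

End packings.

(** * Cutting a family along an open solid set *)

Section cut.
Context {R : realType} {X : topologicalType}.
Hypothesis Xconnected : connected [set: X].
Hypothesis Xlocconn : locally_connected X.
Variable lam : set X -> R.
Hypothesis hlam : solid_set_function lam.
Implicit Types (A B C G K U V W : set X) (s t : seq (set X)).

Lemma solidC A : solid A -> solid (~` A).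
Proof. by move=> [cA cCA]; split; rewrite ?setCK. Qed.

Lemma open_solidC A : open_solid A -> closed_solid (~` A).
Proof. by move=> [oA sA]; split; [exact: open_closedC|exact: solidC]. Qed.

Lemma closed_solidC A : closed_solid A -> open_solid (~` A).
Proof. by move=> [oA sA]; split; [exact: closed_openC|exact: solidC]. Qed.

Lemma open_solid0 : open_solid (@set0 X).
Proof. by split; [exact: open0|split; [exact: connected0|rewrite setC0]]. Qed.

Lemma open_solidT : open_solid (@setT X).
Proof. by split; [exact: openT|split; [|rewrite setCT; exact: connected0]]. Qed.

Lemma lamC A : open_or_closed_solid A -> lam (~` A) = lam setT - lam A.
Proof. by have [_ _ _ /[apply] <-] := hlam; rewrite addrAC subrr add0r. Qed.

Lemma lam0 : lam set0 = 0.
Proof. by rewrite -setCT lamC ?subrr//; left; exact: open_solidT. Qed.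

Lemma lam_sum_le s : disjoint_seq s ->
  (forall A, A \in s -> open_or_closed_solid A) ->
  \sum_(A <- s) lam A <= lam setT.
Proof.
move=> djs ss; have [h1 _ _ _] := hlam.
rewrite (big_nth set0) big_mkord; apply: (h1 _ (fun i : 'I_(size s) => nth set0 s i)).
  by move=> i; apply: ss; exact: mem_nth.
apply/trivIsetP => i j _ _ ij.
move: djs => /(pairwiseP set0) djs.
wlog ltij : i j ij / (i < j)%N.
  move=> wl; case: (ltngtP i j) => [lt|lt|/val_inj e]; first exact: wl.
    by rewrite setIC; apply: wl => //; rewrite eq_sym.
  by rewrite e eqxx in ij.
by apply/eqP; apply: djs; rewrite ?inE.
Qed.

Lemma lam_ge0 A : open_or_closed_solid A -> 0 <= lam A.
Proof.
move=> sA; have sCA : open_or_closed_solid (~` A).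
  by case: sA => sA; [right; exact: open_solidC|left; exact: closed_solidC].
rewrite -[A]setCK lamC// subr_ge0.
have := @lam_sum_le [:: ~` A]; rewrite big_seq1; apply=> // B.
by rewrite inE => /eqP->.
Qed.

Definition solid_pack := pack (@closed_solid X) lam.

Lemma solid_pack_bound s : packing (@closed_solid X) setT s ->
  \sum_(A <- s) lam A <= lam setT.
Proof. by move=> [djs ss _]; apply: lam_sum_le => // A /ss; right. Qed.

Lemma closed_solid_connected A : closed_solid A -> connected A.
Proof. by case=> _ []. Qed.

Lemma solid_pack_open_solid U : open_solid U -> solid_pack U = lam U.
Proof.
move=> sU; apply/eqP; rewrite eq_le; apply/andP; split.
  apply: pack_le => s [djs ss sU'].
  have := @lam_sum_le (~` U :: s); rewrite big_cons lamC; last by left.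
  rewrite disjoint_cons djs andbT => H.
  have: lam setT - lam U + \sum_(A <- s) lam A <= lam setT.
    apply: H => [|A].
      by apply/eqP; apply/disjoints_subset; exact: subsetC.
    rewrite inE => /orP[/eqP->|/ss]; last by right.
    by right; exact: open_solidC.
  by move=> ?; lra.
have [_ /(_ U sU) h2 _ _] := hlam.
rewrite -lee_fin h2; apply: ge_ereal_sup => _ [C [sC CU] <-].
rewrite lee_fin -[leLHS](big_seq1 +%R C lam).
apply: (pack_ge solid_pack_bound); split=> //.
  by move=> A; rewrite inE => /eqP->.
by rewrite cup_seq1.
Qed.

(** The value on a closed connected set: [lam] is taken away from [X] on each
    component of the complement, a possibly infinite sum that the packings by
    closed solid sets compute. *)
Definition lam_conn A := lam setT - solid_pack (~` A).

Lemma lam_conn_solid A : closed_solid A -> lam_conn A = lam A.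
Proof.
move=> sA; rewrite /lam_conn solid_pack_open_solid; last exact: closed_solidC.
by rewrite lamC; [rewrite opprB addrC subrK|right].
Qed.

(** Conservation of mass says that this is [lam setT] for [q] equal to
    [open_mass]. The bound by [lam setT] is first obtained with [solid_pack] as
    [q], because this bound is what makes the supremum in [open_mass] finite. *)
Definition total_mass (q : set X -> R) s :=
  \sum_(A <- s) lam_conn A + q (~` cup s).

Lemma total_mass_perm q s t : perm_eq s t -> total_mass q s = total_mass q t.
Proof.
by move=> st; rewrite /total_mass (perm_big _ st) (eq_mem_cup (perm_mem st)).
Qed.

(** The open set [U] is a union of components of [~` cup t], by the closedness
    of [U `|` cup t]; both complements of unions then split along [U]. *)
Lemma total_mass_cut (q : set X -> R) U s t :
  (forall V W, open V -> open W -> V `&` W = set0 -> q (V `|` W) = q V + q W) ->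
  (forall V, open_solid V -> q V = lam V) ->
  open_solid U -> (forall A, A \in s -> closed A) -> cup s `<=` U ->
  U `&` cup t = set0 -> closed (U `|` cup t) ->
  total_mass q (s ++ t) =
  total_mass q (~` U :: s) + total_mass q t - lam setT.
Proof.
move=> qU qs sU cls sub Ut clUt; rewrite /total_mass big_cat big_cons cup_cat.
rewrite cup_cons /= lam_conn_solid; last exact: open_solidC.
have [oU _] := sU; rewrite lamC; last by left.
have oUs : open (U `\` cup s) by apply: openI => //; exact/closed_openC/closed_cup.
have orest : open (~` (U `|` cup t)) by exact: closed_openC.
have -> : ~` (cup s `|` cup t) = (U `\` cup s) `|` ~` (U `|` cup t).
  apply/seteqP; split=> x.
    move=> /not_orP[sx tx]; have [Ux|Ux] := pselect (U x); first by left.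
    by right=> -[].
  case=> [[Ux sx]|/not_orP[Ux tx]] -[] //.
    by move=> tx; exact: meets_not_disjoint Ut Ux tx.
  by move=> /sub.
have -> : ~` cup t = U `|` ~` (U `|` cup t).
  apply/seteqP; split=> x.
    by move=> tx; have [Ux|Ux] := pselect (U x); [left|right=> -[]].
  case=> [Ux|/not_orP[Ux tx] //] tx.
  exact: meets_not_disjoint Ut Ux tx.
have d1 : (U `\` cup s) `&` ~` (U `|` cup t) = set0.
  by rewrite -subset0 => x [[Ux _]]; apply; left.
have d2 : U `&` ~` (U `|` cup t) = set0.
  by rewrite -subset0 => x [Ux]; apply; left.
rewrite (qU _ _ oUs orest d1) (qU _ _ oU orest d2) (qs U sU).
have -> : ~` (~` U `|` cup s) = U `\` cup s by rewrite setCU setCK setDE.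
by lra.
Qed.

(** * Induction on families of continua *)

(** If [A] is not solid, the other members of the family lie in components of
    [~` A]; cutting along one component that contains some of them leaves two
    families, each of them smaller or with fewer non-solid members. *)
Lemma family_ind (Q : seq (set X) -> Prop) :
  (forall A, continuum A -> Q [:: A]) ->
  (forall s, disjoint_seq s -> (forall A, A \in s -> continuum A) ->
     (forall A, A \in s -> closed_solid A) -> (1 < size s)%N ->
     (forall t, disjoint_seq t -> (forall A, A \in t -> continuum A) ->
        (0 < size t < size s)%N -> Q t) -> Q s) ->
  (forall U s t, open_solid U -> disjoint_seq (s ++ t) ->
     (forall A, A \in s ++ t -> continuum A) -> cup s `<=` U ->
     U `&` cup t = set0 -> closed (U `|` cup t) ->
     Q (~` U :: s) -> Q t -> Q (s ++ t)) ->
  (forall s t, perm_eq s t -> Q s -> Q t) ->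
  forall s, disjoint_seq s -> (forall A, A \in s -> continuum A) ->
    s != [::] -> Q s.
Proof.
move=> Q1 Qsolid Qcut Qperm s.
pose ns t := count (fun A => ~~ `[< solid A >]) t.
have [n] := ubnP (size s); elim: n => // n IHn in s *.
rewrite ltnS => sn.
have [m] := ubnP (ns s); elim: m => // m IHm in s sn *.
rewrite ltnS => sm djs cs sn0.
case: s => [//|A [|B r]] in sn sm djs cs sn0 *; first by apply: Q1; apply: cs; exact: mem_head.
set s := [:: A, B & r] in sn sm djs cs sn0 *.
have [allS|] := boolP (all (fun A => `[< solid A >]) s).
  apply: Qsolid => //.
    by move=> C Cs; split; [case: (cs C Cs)|exact/asboolP/(allP allS)].
  move=> t djt ct /andP[t0 ts]; apply: IHn => //; last by rewrite -size_eq0 -lt0n.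
  exact: leq_trans ts sn.
move=> /allPn[C Cs nsC].
have [clC cC C0] := cs C Cs.
have pr := perm_to_rem Cs; set u := rem C s in pr.
have us : size u = (size s).-1 by rewrite size_rem.
have [D Du] : exists D, D \in u.
  by case uE : u us => [//|D u'] _; exists D; rewrite mem_head.
have um E : E \in u -> E \in s by exact: mem_rem.
have [clD cD [d Dd]] := cs D (um D Du).
have djCu : C `&` cup u = set0 /\ disjoint_seq u.
  by move: djs; rewrite (disjoint_perm pr) disjoint_cons => /andP[/eqP].
have oC : open (~` C) by exact: closed_openC.
have Cd : (~` C) d.
  by move=> Cd; apply: (meets_not_disjoint djCu.1 Cd); exists D.
set U := connected_component (~` C) d.
have cCU : connected (~` U) by exact: connected_setC_component.
have sU : open_solid U.
  by split; [exact: open_component|split=> //; exact: component_connected].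
have inU E : E \in u -> E `<=` U \/ E `&` U = set0.
  move=> Eu; have [_ cE _] := cs E (um E Eu).
  apply: component_dichotomy => // y Ey Cy.
  by apply: (meets_not_disjoint djCu.1 Cy); exists E.
pose p E := `[< E `<=` U >].
pose u1 := [seq E <- u | p E]; pose u2 := [seq E <- u | ~~ p E].
have pu : perm_eq (u1 ++ u2) u by exact/permEl/perm_filterC.
have size12 : (size u1 + size u2)%N = size u by rewrite -size_cat (perm_size pu).
have sn' : ((size u1 + size u2).+1 <= n)%N by rewrite size12 us.
have u1D : D \in u1.
  rewrite mem_filter Du andbT; apply/asboolP; case: (inU D Du) => // DU.
  case: (meets_not_disjoint DU Dd); exact: connected_component_refl.
have u1_gt0 : (0 < size u1)%N by case: (u1) u1D.
have pw : perm_eq (u1 ++ (C :: u2)) s.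
  by rewrite (permPl (permEl (perm_catCA u1 [:: C] u2))) (permPr pr) perm_cons.
apply: (Qperm _ _ pw).
have cw E : E \in u1 ++ C :: u2 -> continuum E by rewrite (perm_mem pw); exact: cs.
have djw : disjoint_seq (u1 ++ C :: u2) by rewrite (disjoint_perm pw).
have /and3P[/eqP u12 dju1 djCu2] : [&& cup u1 `&` cup (C :: u2) == set0,
  disjoint_seq u1 & disjoint_seq (C :: u2)] by rewrite -disjoint_cat.
have u1U : cup u1 `<=` U.
  by apply: cup_sub => E; rewrite mem_filter => /andP[/asboolP].
have UCu2 : U `&` cup (C :: u2) = set0.
  rewrite -subset0 => x [Ux]; rewrite cup_cons => -[Cx|[E]].
    by move/connected_component_sub: Ux; apply.
  rewrite /= mem_filter => /andP[/asboolPn pE Eu] Ex.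
  by case: (inU E Eu) => // EU; exact: meets_not_disjoint EU Ex Ux.
have cu2 E : E \in u2 -> closed E.
  by rewrite mem_filter => /andP[_ /um /cs[]].
apply: (Qcut U) => //.
- rewrite cup_cons setUA; apply: closedU; last exact: closed_cup.
  by have := closed_component_setC (x := d) Xlocconn oC; rewrite setCK.
- have dj1 : disjoint_seq (~` U :: u1).
    rewrite disjoint_cons dju1 andbT; apply/eqP/disjoints_subset.
    exact: subsetC.
  have c1 E : E \in ~` U :: u1 -> continuum E.
    rewrite inE => /orP[/eqP->|Eu1]; last by apply: cw; rewrite mem_cat Eu1.
    split; [by case: (open_solidC sU)|by []|].
    case: C0 => c Cc; exists c => Uc.
    by move/connected_component_sub: Uc; apply.
  have [u20|] := eqVneq u2 [::]; last first.
    rewrite -size_eq0 -lt0n => u2_gt0; apply: IHn => //=.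
    by apply: leq_trans sn'; rewrite ltnS -addn1 leq_add2l.
  have u1u : size u1 = size u by rewrite -size12 u20 addn0.
  (* the size does not drop, but the solid [~` U] replaces the non-solid [C] *)
  apply: IHm => //=; first by rewrite u1u us; exact: sn.
  apply: leq_trans sm; rewrite /ns -(permP pw) u20 count_cat/= nsC.
  have /asboolT -> /= : solid (~` U) by case: (open_solidC sU).
  by rewrite add0n addn0 addn1.
- apply: IHn => //.
    by apply: leq_trans sn'; rewrite ltnS /= -add1n leq_add2r.
  by move=> E Eu; apply: cw; rewrite mem_cat Eu orbT.
Qed.

End cut.

(** * Conservation of mass *)

Section mass.
Context {R : realType} {X : topologicalType}.
Hypothesis Xcompact : compact [set: X].
Hypothesis Xhausdorff : hausdorff_space X.
Hypothesis Xconnected : connected [set: X].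
Hypothesis Xlocconn : locally_connected X.
Variable lam : set X -> R.
Hypothesis hlam : solid_set_function lam.
Implicit Types (A B C G K U V W : set X) (s t : seq (set X)).

Local Notation solid_pack := (solid_pack lam).
Local Notation lam_conn := (lam_conn lam).
Local Notation total_mass := (total_mass lam).

Let lamT_ge0 : 0 <= lam setT.
Proof. by apply: lam_ge0 => //; left; exact: open_solidT. Qed.

Lemma solid_packU U V : open U -> open V -> U `&` V = set0 ->
  solid_pack (U `|` V) = solid_pack U + solid_pack V.
Proof.
apply: packU; first exact: solid_pack_bound.
exact: closed_solid_connected.
Qed.

Lemma total_mass_solid_le s : disjoint_seq s ->
  (forall A, A \in s -> continuum A) -> s != [::] ->
  total_mass solid_pack s <= lam setT.
Proof.
move: s; apply: family_ind => //.
- by move=> A _; rewrite /total_mass big_seq1 cup_seq1 subrK.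
- move=> s djs _ ss _ _; rewrite /total_mass.
  rewrite (eq_big_seq lam); last by move=> A /ss; exact: lam_conn_solid.
  rewrite -lerBrDl; apply: pack_le => t [djt ts tU].
  rewrite lerBrDl -big_cat; apply: lam_sum_le => //.
    rewrite disjoint_cat djs djt !andbT; apply/eqP; rewrite setIC.
    exact/disjoints_subset.
  by move=> A; rewrite mem_cat => /orP[/ss|/ts]; right.
- move=> U s t sU dj c sub Ut clUt.
  rewrite (total_mass_cut hlam (s := s) (t := t) solid_packU _ sU)//.
  + lra.
  + exact: solid_pack_open_solid.
  + by move=> A As; have [] := c A; rewrite ?mem_cat ?As.
- by move=> s t st; rewrite (total_mass_perm _ _ st).
Qed.

Lemma continuum_connected A : continuum A -> connected A.
Proof. by case. Qed.

Lemma lam_conn_bound s : packing (@continuum X) setT s ->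
  \sum_(A <- s) lam_conn A <= lam setT.
Proof.
move=> [djs cs _]; have [->|s0] := eqVneq s [::]; first by rewrite big_nil.
apply: le_trans (total_mass_solid_le djs cs s0).
by rewrite lerDl; exact: (pack_ge0 (solid_pack_bound hlam)).
Qed.

Definition open_mass := pack (@continuum X) lam_conn.

Lemma open_massU U V : open U -> open V -> U `&` V = set0 ->
  open_mass (U `|` V) = open_mass U + open_mass V.
Proof. exact: packU lam_conn_bound continuum_connected _ _. Qed.

Lemma open_massS U V : U `<=` V -> open_mass U <= open_mass V.
Proof. exact: packS lam_conn_bound _ _. Qed.

Lemma solid_pack_le_open_mass U : solid_pack U <= open_mass U.
Proof.
apply: pack_le => s sU; have [_ ss _] := sU.
rewrite (bigID (fun A => A == set0))/= big1 ?add0r; last first.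
  by move=> A /eqP->; exact: lam0.
rewrite -big_filter (eq_big_seq lam_conn); last first.
  by move=> A; rewrite mem_filter => /andP[_ /ss sA]; rewrite lam_conn_solid.
apply: (pack_ge lam_conn_bound); case: sU => djs _ sU; split.
- exact: disjoint_filter.
- move=> A; rewrite mem_filter => /andP[/set0P A0 /ss[clA [cA _]]].
  by split.
- by apply: subset_trans sU; apply: cup_subset => A; rewrite mem_filter => /andP[].
Qed.

Lemma open_mass_open_solid U : open_solid U -> open_mass U = lam U.
Proof.
move=> sU; apply/eqP; rewrite eq_le; apply/andP; split; last first.
  by rewrite -(solid_pack_open_solid hlam sU); exact: solid_pack_le_open_mass.
have [CU0|/set0P CU0] := eqVneq (~` U) set0.
  have -> : U = setT by rewrite -[U]setCK CU0 setC0.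
  exact: pack_le_bound lam_conn_bound _.
apply: pack_le => s [djs cs sUs].
have sCU := open_solidC sU.
have := @lam_conn_bound (~` U :: s); rewrite big_cons lam_conn_solid//.
rewrite lamC//; last by left.
move=> H; suff : lam setT - lam U + \sum_(A <- s) lam_conn A <= lam setT by lra.
apply: H; split=> //.
  rewrite disjoint_cons djs andbT; apply/eqP/disjoints_subset.
  exact: subsetC.
move=> A; rewrite inE => /orP[/eqP->|/cs//].
by split=> //; [case: sCU|case: sCU => _ []].
Qed.

(** Inner regularity of [lam] on the open solid set [~` A], in terms of
    complements. *)
Lemma lam_outer A e : 0 < e -> closed_solid A ->
  exists V, [/\ open_solid V, A `<=` V & lam V <= lam A + e].
Proof.
move=> e0 sA; have [_ /(_ _ (closed_solidC sA)) h2 _ _] := hlam.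
have : ((lam (~` A) - e)%R%:E < ereal_sup
    [set (lam C)%:E | C in [set C | closed_solid C /\ C `<=` ~` A]])%E.
  by rewrite -h2 lte_fin ltrBlDr ltrDl.
move=> /ereal_sup_gt[_ [C [sC CA] <-]]; rewrite lte_fin => lt.
exists (~` C); split; [exact: closed_solidC|exact: subsetCr|].
by move: lt; rewrite !lamC//; [lra|right|right].
Qed.

(** When the complement of the solid sets of [s] is connected, it contains a
    continuum [E] so large that the component of [~` E] around each [A] in [s]
    is contained in a neighbourhood of [A] of nearly the same measure. *)
Lemma total_mass_ge_connected s : disjoint_seq s ->
  (forall A, A \in s -> continuum A) -> (forall A, A \in s -> closed_solid A) ->
  (1 < size s)%N -> connected (~` cup s) ->
  lam setT <= total_mass open_mass s.
Proof.
move=> djs cs ss s1 cG; set G := ~` cup s.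
have us : uniq s by apply: uniq_disjoint => // A /cs[].
have cls A : A \in s -> closed A by move=> /cs[].
have oG : open G by apply: closed_openC; exact: closed_cup.
have [x0 Gx0] : G !=set0.
  rewrite /G; case sE : s s1 => [//|A [//|B r]] _; rewrite cup_cons.
  have ABs C : C \in B :: r -> C \in s by move=> Cr; rewrite sE in_cons Cr orbT.
  apply: not_connected_two_closed => //.
  - by apply: cls; rewrite sE mem_head.
  - by apply: closed_cup => C /ABs /cls.
  - by have [] := cs A; rewrite // sE mem_head.
  - have [_ _ [b Bb]] := cs B (ABs _ (mem_head _ _)).
    by exists b; exists B => //=; rewrite mem_head.
  - by move: djs; rewrite sE disjoint_cons => /andP[/eqP].
apply/ler_addgt0Pr => e e0.
(* the error [e] is shared equally among the members of [s] *)
pose d := e / (size s)%:R.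
have s_gt0 : 0 < (size s)%:R :> R by rewrite ltr0n ltnW.
have d0 : 0 < d by exact: divr_gt0.
have [V hV] : {V : set X -> set X & forall A, A \in s ->
    [/\ open_solid (V A), A `<=` V A & lam (V A) <= lam A + d]}.
  apply: (@choice _ _ (fun A V => A \in s ->
    [/\ open_solid V, A `<=` V & lam V <= lam A + d])) => A.
  have [As|/negP As] := boolP (A \in s); last by exists set0.
  by have [W ?] := lam_outer d0 (ss A As); exists W.
have [f [fo fdj]] := disjoint_open_nbhs Xcompact Xhausdorff cls djs.
pose N A := V A `&` f A.
have oN A : A \in s -> open (N A).
  by move=> As; apply: openI; [case: (hV A As) => -[]|case: (fo A As)].
have AN A : A \in s -> A `<=` N A.
  by move=> As x Ax; split; [case: (hV A As) => _ + _|case: (fo A As) => _]; exact.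
have oNs : open (cup (map N s)).
  by apply: open_cup => _ /mapP[A As ->]; exact: oN.
have [||E [clE cE Ex0 NE EG]] := @connected_open_exhaust _ Xcompact
  Xhausdorff Xlocconn G (~` cup (map N s)) x0 oG cG Gx0.
- exact: open_closedC.
- apply: subsetC; apply: cup_sub => A As; apply: subset_trans (AN A As) _.
  by apply: sub_cup; rewrite map_f.
have contE : continuum E by split=> //; exists x0.
have oCE : open (~` E) by exact: closed_openC.
have AE A : A \in s -> A `<=` ~` E.
  by move=> As x Ax /EG; apply; exists A.
have [a ha] : {a : set X -> X & forall A, A \in s -> A (a A)}.
  apply: (@choice _ _ (fun A x => A \in s -> A x)) => A.
  have [/cs[_ _ [x Ax]]|/negP As] := boolP (A \in s); first by exists x.
  by exists x0.
pose U A := connected_component (~` E) (a A).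
have sU A : A \in s -> open_solid (U A).
  move=> As; split; first exact: open_component.
  split; first exact: component_connected.
  by apply: connected_setC_component => //; exists x0.
have AU A : A \in s -> A `<=` U A.
  move=> As; apply: connected_component_max; [exact: ha|exact: AE|].
  by case: (cs A As).
have UN A : A \in s -> U A `<=` N A.
  move=> As; have Aa := ha A As.
  pose N' := cup (map N (rem A s)).
  have NN' : N A `&` N' = set0.
    rewrite -subset0 => x [[_ fx] [_ /mapP[B Bs ->] [_ fBx]]].
    move: Bs; rewrite mem_rem_uniq// => /andP[/= BA Bs].
    by apply: (meets_not_disjoint (fdj A B As Bs _) fx fBx); rewrite eq_sym.
  have oN' : open N'.
    by apply: open_cup => _ /mapP[B /mem_rem Bs ->]; exact: oN.
  have UAN : U A `<=` N A `|` N'.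
    move=> x /connected_component_sub Ex; apply: contrapT => Nx; apply: Ex.
    apply: NE => -[_ /mapP[B Bs ->] NBx]; apply: Nx.
    have [<-|AB] := eqVneq B A; first by left.
    by right; exists (N B) => //; apply/map_f; rewrite mem_rem_uniq// !inE AB.
  have [//|UN'] := connected_sub_openU (@component_connected _ _ _) (oN A As)
    oN' NN' UAN.
  have := UN' _ (AU A As _ Aa).
  by move=> N'a; case: (meets_not_disjoint NN' (AN A As _ Aa) N'a).
pose W := cup (map U s).
have oU A : A \in map U s -> open A by move=> /mapP[B Bs ->]; case: (sU B Bs).
have djU : disjoint_seq (map U s).
  apply: disjoint_map => // A B As Bs AB; rewrite -subset0 -(fdj A B As Bs AB).
  by move=> x [/(UN A As)[_ ?] /(UN B Bs)[_ ?]].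
have clEW : closed (E `|` W).
  rewrite /W; elim: (s) => [|A r IHr] /=; first by rewrite cup_nil setU0.
  have -> : E `|` cup (U A :: map U r) = (U A `|` ~` ~` E) `|` (E `|` cup (map U r)).
    by rewrite setCK cup_cons setUCA -[RHS]setUA [in RHS](setUA E) setUid.
  by apply: closedU => //; exact: closed_component_setC.
pose rest := ~` (E `|` W).
have orest : open rest by exact: closed_openC.
have packE : solid_pack (~` E) = \sum_(A <- s) lam (U A) + solid_pack rest.
  have -> : ~` E = W `|` rest.
    apply/seteqP; split=> x.
      move=> Ex; have [Wx|Wx] := pselect (W x); first by left.
      by right=> -[].
    case=> [[_ /mapP[A As ->] /connected_component_sub //]|Ex' Ex].
    by apply: Ex'; left.
  rewrite solid_packU//; last 2 first.
  - exact: open_cup.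
  - by rewrite -subset0 => x [Wx]; apply; right.
  congr (_ + _).
  rewrite [LHS](pack_cup (solid_pack_bound hlam) (@closed_solid_connected _))//.
  rewrite big_map; apply: eq_big_seq => A As.
  exact: solid_pack_open_solid (sU A As).
have lamU : \sum_(A <- s) lam (U A) <= \sum_(A <- s) lam A + e.
  have -> : \sum_(A <- s) lam A + e = \sum_(A <- s) (lam A + d).
    rewrite big_split/=; congr (_ + _).
    by rewrite big_const_seq count_predT iter_addr_0 -mulr_natr divfK// gt_eqF.
  rewrite !big_seq; apply: ler_sum => A As.
  have [sV _ lamV] := hV A As; apply: le_trans lamV.
  rewrite -(solid_pack_open_solid hlam (sU A As)) -(solid_pack_open_solid hlam sV).
  apply: (packS (solid_pack_bound hlam)).
  by move=> x /(UN A As)[].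
have massG : lam_conn E + solid_pack rest <= open_mass G.
  apply: le_trans (pack_setD lam_conn_bound contE EG); rewrite lerD2l.
  apply: le_trans (solid_pack_le_open_mass _) _; apply: open_massS => x restx.
  split; last by move=> Ex; apply: restx; left.
  move=> [A As Ax]; apply: restx; right; exists (U A); last exact: AU.
  exact/map_f.
rewrite /total_mass (eq_big_seq lam); last by move=> A /ss; exact: lam_conn_solid.
by move: massG; rewrite /G {1}/lam_conn packE; lra.
Qed.

(** The members of [s] and the components of the complement form an
    irreducible partition. *)
Lemma total_mass_ge_irreducible s : disjoint_seq s ->
  (forall A, A \in s -> continuum A) -> (forall A, A \in s -> closed_solid A) ->
  (1 < size s)%N -> ~ connected (~` cup s) ->
  (forall t, subseq t s -> (size t < size s)%N -> connected (~` cup t)) ->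
  lam setT <= total_mass open_mass s.
Proof.
move=> djs cs ss s1 ncG sub.
have us : uniq s by apply: uniq_disjoint => // A /cs[].
have cls A : A \in s -> closed A by move=> /cs[].
have s0 A : A \in s -> A !=set0 by move=> /cs[].
have crem A : A \in s -> connected (~` cup (rem A s)).
  move=> As; apply: sub; first exact: rem_subseq.
  by rewrite size_rem// prednK// ltnW.
have oG : open (~` cup s) by apply: closed_openC; exact: closed_cup.
have [t [djt tc tG]] := finite_components_family Xcompact Xhausdorff Xlocconn
  cls s0 djs crem s1.
have st W : W \in t -> open_solid W.
  move=> /tc[x Gx ->]; split; first exact: open_component.
  split; first exact: component_connected.
  apply: connected_setC_component_family => //; last by case: (s) s1.
  by move=> A /cs[].
have t0 W : W \in t -> W !=set0.
  by move=> /tc[x Gx ->]; exists x; exact: connected_component_refl.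
have djst : disjoint_seq (s ++ t).
  by rewrite disjoint_cat djs djt tG setICr eqxx.
have st0 A : A \in s ++ t -> A !=set0.
  by rewrite mem_cat => /orP[/s0|/t0].
have ust : uniq (s ++ t) by exact: uniq_disjoint.
have [a [A0 A0s A0a]] : exists a, cup s a.
  case: (s) s1 s0 => [//|A r] _ s0'; have [a Aa] := s0' A (mem_head _ _).
  by exists a, A => //=; rewrite mem_head.
(* hence the closed solid members of the partition are those of [s] *)
have t_not_closed W : W \in t -> ~ closed W.
  move=> Wt clW; have [oW _] := st W Wt.
  have WT : W = setT.
    apply: (connected_clopen Xconnected) => //; first exact: t0.
    by rewrite setIT -(closure_id W).1.
  have : cup t a by exists W => //; rewrite WT.
  by rewrite tG; apply; exists A0.
pose F (i : 'I_(size (s ++ t))) := nth set0 (s ++ t) i.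
have Fst i : F i \in s ++ t by exact: mem_nth.
have Finj : injective F.
  by move=> i j /eqP; rewrite nth_uniq// => /eqP/val_inj.
have FsP i : closed_solid (F i) -> F i \in s.
  move=> [clF _]; have := Fst i; rewrite mem_cat => /orP[//|Ft].
  by case: (t_not_closed _ Ft).
have Fex A : A \in s ++ t -> exists i, F i = A.
  move=> Ast; have lt : (index A (s ++ t) < size (s ++ t))%N by rewrite index_mem.
  by exists (Ordinal lt); rewrite /F nth_index.
have h3 : irreducible_partition F.
  split.
    split.
    - by move=> i; have := Fst i; rewrite mem_cat => /orP[/ss|/st]; [right|left].
    - by move=> i; exact: st0.
    - apply/trivIsetP => i j _ _ ij; apply: (disjoint_mem djst) => //.
      by apply: contra_neq ij => /Finj.
    - apply/seteqP; split=> // x _.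
      have [sx|tx] := pselect (cup s x).
        have [A As Ax] := sx; have [|i Fi] := Fex A; first by rewrite mem_cat As.
        by exists i => //; rewrite Fi.
      have [A At Ax] : cup t x by rewrite tG.
      have [|i Fi] := Fex A; first by rewrite mem_cat /= At orbT.
      by exists i => //; rewrite Fi.
  move=> J [JS nSJ].
  pose p A := `[< exists2 i, J i & F i = A >].
  have -> : \bigcup_(i in J) F i = cup [seq A <- s | p A].
    apply/seteqP; split=> [x [i Ji Fx]|x [A]].
      exists (F i) => //=; rewrite mem_filter; apply/andP; split.
        by apply/asboolP; exists i.
      by apply: FsP; exact: JS.
    by rewrite /= mem_filter => /andP[/asboolP[i Ji <-] _] Fx; exists i.
  apply: sub; first exact: filter_subseq.
  rewrite size_filter ltn_neqAle count_size andbT -all_count.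
  apply/negP => /allP ps; apply: nSJ => i /= /FsP /ps /asboolP[j Jj /Finj <-].
  exact: Jj.
have [_ _ /(_ _ _ h3) h _] := hlam.
rewrite -h -(big_mkord xpredT (fun i => lam (nth set0 (s ++ t) i))).
rewrite -(big_nth set0 xpredT) big_cat/= /total_mass.
rewrite (eq_big_seq lam (F1 := lam_conn)); last by move=> A /ss; exact: lam_conn_solid.
rewrite lerD2l -tG [leRHS](pack_cup lam_conn_bound continuum_connected)//; last first.
  by move=> W /st[].
by rewrite !big_seq; apply: ler_sum => W Wt; rewrite -open_mass_open_solid//; exact: st.
Qed.

(** A disconnecting family of solid sets contains a minimal one [J]. If [J] is
    not everything, some other member lies in a component [U] of [~` cup J],
    and cutting along [U] leaves two smaller families, as [J] has at least two
    members. *)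
Lemma total_mass_ge s : disjoint_seq s ->
  (forall A, A \in s -> continuum A) -> s != [::] ->
  lam setT <= total_mass open_mass s.
Proof.
have cut U s' t' : open_solid U -> (forall A, A \in s' -> closed A) ->
    cup s' `<=` U -> U `&` cup t' = set0 -> closed (U `|` cup t') ->
    lam setT <= total_mass open_mass (~` U :: s') ->
    lam setT <= total_mass open_mass t' ->
    lam setT <= total_mass open_mass (s' ++ t').
  move=> sU cls sub Ut clUt.
  rewrite (total_mass_cut hlam (s := s') (t := t') open_massU _ sU)//.
    lra.
  exact: open_mass_open_solid.
move: s; apply: family_ind => //; last by move=> s t st; rewrite (total_mass_perm _ _ st).
- move=> A cA; rewrite /total_mass big_seq1 cup_seq1 -lerBlDl /lam_conn opprB.
  by rewrite addrC subrK; exact: solid_pack_le_open_mass.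
- move=> s djs cs ss s1 IHs.
  have [cG|ncG] := pselect (connected (~` cup s)).
    exact: total_mass_ge_connected.
  (* [J] is a disconnecting subfamily of the least size [n] *)
  pose bad n := `[< exists t, [/\ subseq t s, ~ connected (~` cup t) & size t = n] >].
  have exbad : exists n, bad n by exists (size s); apply/asboolP; exists s; split.
  have [n /asboolP[J [Js ncJ Jn]] minJ] := ex_minnP exbad.
  have Jsub A : A \in J -> A \in s by exact: mem_subseq.
  have us : uniq s by apply: uniq_disjoint => // A /cs[].
  have uJ : uniq J by exact: subseq_uniq us.
  have djJ : disjoint_seq J by exact: subseq_pairwise djs.
  have cJ t : subseq t J -> (size t < size J)%N -> connected (~` cup t).
    move=> tJ tlt; apply: contrapT => nct.
    suff : (n <= size t)%N by rewrite leqNgt -Jn tlt.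
    apply: minJ; apply/asboolP; exists t; split=> //.
    exact: subseq_trans tJ Js.
  have J1 : (1 < size J)%N.
    case JE : J ncJ => [|A [|//]] ncJ; exfalso; apply: ncJ.
      by rewrite cup_nil setC0.
    rewrite cup_seq1; have /ss : A \in s by apply: Jsub; rewrite JE mem_head.
    by case=> _ [].
  pose K := [seq A <- s | A \notin J].
  have sJK : perm_eq s (J ++ K).
    rewrite -(permPl (permEl (perm_filterC (mem J) s))) perm_cat2r.
    apply: uniq_perm => //; first exact: filter_uniq.
    by move=> A; rewrite mem_filter /=; case: (boolP (A \in J)) => // /Jsub.
  have [K0|] := eqVneq K [::].
    rewrite (total_mass_perm _ _ sJK) K0 cats0.
    by apply: total_mass_ge_irreducible => // A /Jsub; [exact: cs|exact: ss].
  move=> Kn0; have [B BK] : exists B, B \in K.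
    by case: (K) Kn0 => // B r _; exists B; rewrite mem_head.
  have Ksub A : A \in K -> A \in s by rewrite mem_filter => /andP[].
  have [_ _ [b Bb]] := cs B (Ksub _ BK).
  have JK : cup J `&` cup K = set0.
    by apply/eqP; move: djs; rewrite (disjoint_perm sJK) disjoint_cat => /and3P[].
  have KJ A : A \in K -> A `<=` ~` cup J.
    by move=> AK x Ax Jx; apply: (meets_not_disjoint JK Jx); exists A.
  pose U := connected_component (~` cup J) b.
  have oJ : open (~` cup J).
    by apply/closed_openC/closed_cup => A /Jsub /cs[].
  have sU : open_solid U.
    split; first exact: open_component.
    split; first exact: component_connected.
    apply: connected_setC_component_family => //; try by move=> A /Jsub /cs[].
    + move=> A AJ; apply: cJ; first exact: rem_subseq.
      by rewrite size_rem// prednK// ltnW.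
    + by case: (J) J1.
    + exact: KJ Bb.
  pose p A := `[< A `<=` U >].
  pose u := [seq A <- K | p A]; pose v := [seq A <- K | ~~ p A].
  have uvK : perm_eq (u ++ v) K by exact/permEl/perm_filterC.
  have uK A : A \in u -> A \in K by rewrite mem_filter => /andP[].
  have vK A : A \in v -> A \in K by rewrite mem_filter => /andP[].
  have Bu : B \in u.
    rewrite mem_filter BK andbT; apply/asboolP.
    apply: connected_component_max => //; first exact: KJ.
    by have [] := cs B (Ksub _ BK).
  have u_gt0 : (0 < size u)%N by case: (u) Bu.
  have perm_s : perm_eq (u ++ (J ++ v)) s.
    by rewrite perm_catCA perm_sym (permPl sJK) perm_cat2l perm_sym.
  have size_s : size s = (size u + (size J + size v))%N.
    by rewrite -!size_cat (perm_size perm_s).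
  have djuJv : disjoint_seq (u ++ (J ++ v)) by rewrite (disjoint_perm perm_s).
  have /and3P[_ dju djJv] : [&& cup u `&` cup (J ++ v) == set0,
    disjoint_seq u & disjoint_seq (J ++ v)] by rewrite -disjoint_cat.
  have uU : cup u `<=` U.
    by apply: cup_sub => A; rewrite mem_filter => /andP[/asboolP].
  rewrite -(total_mass_perm _ _ perm_s); apply: (cut U) => //.
  + by move=> A /uK /Ksub /cs[].
  + rewrite cup_cat setIUr -subset0 subUset; split=> x [Ux].
      by move: Ux => /connected_component_sub.
    move=> [A /=]; rewrite mem_filter => /andP[/asboolPn pA AK] Ax.
    have cA : connected A by have [] := cs A (Ksub _ AK).
    have [//|AU] := component_dichotomy b cA (KJ A AK).
    exact: meets_not_disjoint AU Ax Ux.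
  + rewrite cup_cat setUA; apply: closedU.
      by have := closed_component_setC (x := b) Xlocconn oJ; rewrite setCK.
    by apply: closed_cup => A /vK /Ksub /cs[].
  + apply: IHs => /=.
    * by rewrite disjoint_cons dju andbT; apply/eqP/disjoints_subset/subsetC.
    * move=> A; rewrite inE => /orP[/eqP->|/uK/Ksub/cs//].
      have [clU [cU _]] := open_solidC sU; split=> //.
      case JE : J J1 => [//|C r] _; have CJ : C \in J by rewrite JE mem_head.
      have [_ _ [c Cc]] := cs C (Jsub _ CJ); exists c => /connected_component_sub.
      by apply; exists C.
    * rewrite size_s -addn1 ltn_add2l; apply: leq_trans J1 _; exact: leq_addr.
  + apply: IHs => //.
    * move=> A; rewrite mem_cat => /orP[/Jsub/cs//|/vK/Ksub/cs//].
    * rewrite size_cat size_s addn_gt0 (ltnW J1)/=.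
      by rewrite -[X in (X < _)%N]add0n ltn_add2r.
- move=> U s t sU dj c sub Ut clUt; apply: cut => //.
  by move=> A As; have [] := c A; rewrite ?mem_cat ?As.
Qed.

Lemma total_mass_eq s : disjoint_seq s -> (forall A, A \in s -> continuum A) ->
  \sum_(A <- s) lam_conn A + open_mass (~` cup s) = lam setT.
Proof.
move=> djs cs; have [->|s0] := eqVneq s [::].
  rewrite big_nil add0r cup_nil setC0 open_mass_open_solid//.
  exact: open_solidT.
apply/eqP; rewrite eq_le (total_mass_ge djs cs s0) andbT.
rewrite -lerBrDl; apply: pack_le => t [djt ct tU].
rewrite lerBrDl -big_cat; apply: lam_conn_bound; split=> //.
  rewrite disjoint_cat djs djt !andbT; apply/eqP; rewrite setIC.
  exact/disjoints_subset.
by move=> A; rewrite mem_cat => /orP[/cs|/ct].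
Qed.

End mass.

(** * The topological measure *)

Section existence.
Context {R : realType} {X : topologicalType}.
Hypothesis Xcompact : compact [set: X].
Hypothesis Xhausdorff : hausdorff_space X.
Hypothesis Xconnected : connected [set: X].
Hypothesis Xlocconn : locally_connected X.
Variable lam : set X -> R.
Hypothesis hlam : solid_set_function lam.
Implicit Types (A B C G K U V W : set X) (s t : seq (set X)).

Local Notation open_mass := (open_mass lam).
Local Notation lam_conn := (lam_conn lam).

Let bound s := @lam_conn_bound _ _ Xconnected Xlocconn lam hlam s.
Let mass_eq s := @total_mass_eq _ _ Xcompact Xhausdorff Xconnected Xlocconn
  lam hlam s.
Let massS U V := @open_massS _ _ Xconnected Xlocconn lam hlam U V.
Let mass_solid U := @open_mass_open_solid _ _ Xconnected Xlocconn lam hlam U.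
Let between := continua_between Xcompact Xhausdorff Xlocconn.

Definition solid_extension A : R :=
  if `[< open A >] then open_mass A else lam setT - open_mass (~` A).

Lemma solid_extension_open U : open U -> solid_extension U = open_mass U.
Proof. by move=> /asboolT oU; rewrite /solid_extension oU. Qed.

Lemma open_mass0 : open_mass set0 = 0.
Proof. by rewrite mass_solid ?(lam0 Xconnected hlam)//; exact: open_solid0. Qed.

Lemma open_massT : open_mass setT = lam setT.
Proof. by rewrite mass_solid//; exact: open_solidT. Qed.

Lemma solid_extension_closed C : closed C ->
  solid_extension C = lam setT - open_mass (~` C).
Proof.
move=> clC; rewrite /solid_extension; case: asboolP => // oC.
have [->|/set0P C0] := eqVneq C set0.
  by rewrite setC0 open_massT open_mass0 subrr.
have -> : C = setT.
  by apply: (connected_clopen Xconnected) => //; rewrite setIT -(closure_id C).1.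
by rewrite setCT open_massT open_mass0 subr0.
Qed.

(** A closed subset [C] of [U] has at most the measure of [U]: a finite union
    of continua between them conserves mass. *)
Lemma open_mass_cover C U : closed C -> open U -> C `<=` U ->
  lam setT <= open_mass U + open_mass (~` C).
Proof.
move=> clC oU CU; have [s [djs cs Cs sU]] := between clC oU CU.
rewrite -(mass_eq djs cs); apply: lerD.
  exact: (pack_ge bound).
by apply: massS; exact: subsetC.
Qed.

(** This is additivity on the disjoint closed sets [A] and [B], in terms of
    their complements. Both inequalities come from replacing [A] and [B] by
    finite unions of continua around them, on which mass is conserved. *)
Lemma open_mass_setCU A B : closed A -> closed B -> A `&` B = set0 ->
  open_mass (~` A) + open_mass (~` B) = lam setT + open_mass (~` (A `|` B)).
Proof.
move=> clA clB AB; have oCA : open (~` A) by exact: closed_openC.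
have oCB : open (~` B) by exact: closed_openC.
have clcup s : (forall C, C \in s -> continuum C) -> closed (cup s).
  by move=> cs; apply: closed_cup => C /cs[].
apply/eqP; rewrite eq_le; apply/andP; split.
  rewrite -lerBrDr; apply: pack_le => s sA; have [djs cs subA] := sA.
  rewrite lerBrDl -lerBrDr; apply: pack_le => t tB; have [djt ct subB] := tB.
  rewrite lerBrDr.
  have As : A `<=` ~` cup s by exact: subsetCr.
  have Bt : B `<=` ~` cup t by exact: subsetCr.
  have oA : open (~` cup s `&` ~` B).
    by apply: openI => //; apply: closed_openC; exact: clcup.
  have [|u [dju cu Au uS]] := between clA oA.
    by move=> x Ax; split; [exact: As|move=> Bx; exact: meets_not_disjoint AB Ax Bx].
  have oB : open (~` cup t `&` ~` cup u).
    by apply: openI; apply: closed_openC; exact: clcup.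
  have [|v [djv cv Bv vT]] := between clB oB.
    by move=> x Bx; split; [exact: Bt|move=> /uS[]].
  have djuv : disjoint_seq (u ++ v).
    rewrite disjoint_cat dju djv !andbT; apply/eqP.
    by rewrite -subset0 => x [ux /vT[]].
  have cuv C : C \in u ++ v -> continuum C by rewrite mem_cat => /orP[/cu|/cv].
  have := mass_eq djuv cuv; rewrite big_cat/=.
  have := mass_eq dju cu; have := mass_eq djv cv.
  have : \sum_(C <- s) lam_conn C <= open_mass (~` cup u).
    by apply: (pack_ge bound); split=> // x sx /uS[].
  have : \sum_(C <- t) lam_conn C <= open_mass (~` cup v).
    by apply: (pack_ge bound); split=> // x tx /vT[].
  have : open_mass (~` cup (u ++ v)) <= open_mass (~` (A `|` B)).
    by apply: massS; rewrite cup_cat; apply: subsetC; exact: setUSS.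
  lra.
rewrite addrC -lerBrDr; apply: pack_le => t [djt ct sub].
rewrite lerBrDr.
have oA : open (~` cup t `&` ~` B).
  by apply: openI => //; apply: closed_openC; exact: clcup.
have [|s [djs cs As sS]] := between clA oA.
  move=> x Ax; split; last by move=> Bx; exact: meets_not_disjoint AB Ax Bx.
  by move=> /sub; apply; left.
have : open_mass (~` cup s) <= open_mass (~` A) by apply: massS; exact: subsetC.
have := mass_eq djs cs.
have : \sum_(C <- s ++ t) lam_conn C <= open_mass (~` B).
  apply: (pack_ge bound); split.
  - rewrite disjoint_cat djs djt !andbT; apply/eqP.
    by rewrite -subset0 => x [/sS[]].
  - by move=> C; rewrite mem_cat => /orP[/cs|/ct].
  - rewrite cup_cat subUset; split; first by move=> x /sS[].
    by move=> x /sub ABx Bx; apply: ABx; right.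
rewrite big_cat/=; lra.
Qed.

Lemma solid_extension_ge0 A : open_or_closed A -> 0 <= solid_extension A.
Proof.
case=> [oA|clA].
  by rewrite solid_extension_open//; exact: (pack_ge0 bound).
by rewrite solid_extension_closed// subr_ge0; exact: pack_le_bound bound _.
Qed.

Lemma solid_extensionU A B : open_or_closed A -> open_or_closed B ->
  open_or_closed (A `|` B) -> A `&` B = set0 ->
  solid_extension (A `|` B) = solid_extension A + solid_extension B.
Proof.
have massU U V := @open_massU _ _ Xconnected Xlocconn lam hlam U V.
have clU C D : closed C -> closed D -> C `&` D = set0 ->
    solid_extension (C `|` D) = solid_extension C + solid_extension D.
  move=> clC clD CD; have := open_mass_setCU clC clD CD.
  by rewrite !solid_extension_closed//; [lra|exact: closedU].
have coU C U : closed C -> open U -> open_or_closed (C `|` U) ->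
    C `&` U = set0 -> solid_extension (C `|` U) = solid_extension C + solid_extension U.
  move=> clC oU [oCU|clCU] CU0; rewrite (solid_extension_closed clC) (solid_extension_open oU).
    have clV : closed (~` (C `|` U)) by exact: open_closedC.
    have disV : C `&` ~` (C `|` U) = set0.
      by rewrite -subset0 => x [Cx]; apply; left.
    have := open_mass_setCU clC clV disV.
    have -> : ~` (C `|` ~` (C `|` U)) = U.
      apply/seteqP; split=> x; last first.
        by move=> Ux [Cx|]; [exact: meets_not_disjoint CU0 Cx Ux|apply; right].
      move=> CUx; apply: contrapT => Ux; apply: CUx.
      have [Cx|Cx] := pselect (C x); first by left.
      by right=> -[].
    by rewrite setCK (solid_extension_open oCU); lra.
  rewrite solid_extension_closed//.
  have oV : open (~` (C `|` U)) by exact: closed_openC.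
  have -> : ~` C = U `|` ~` (C `|` U).
    apply/seteqP; split=> x.
      by move=> Cx; have [Ux|Ux] := pselect (U x); [left|right=> -[]].
    case=> [Ux Cx|CUx Cx]; first exact: meets_not_disjoint CU0 Cx Ux.
    by apply: CUx; left.
  rewrite massU//; last by rewrite -subset0 => x [Ux]; apply; right.
  lra.
move=> [oA|clA] [oB|clB] AB dAB.
- by rewrite !solid_extension_open//; [exact: massU|exact: openU].
- by rewrite setUC addrC; apply: coU; rewrite // 1?setUC 1?setIC.
- exact: coU.
- exact: clU.
Qed.

Lemma solid_extension_regular U : open U -> (solid_extension U)%:E =
  ereal_sup [set (solid_extension C)%:E | C in [set C | closed C /\ C `<=` U]].
Proof.
move=> oU; apply/eqP; rewrite eq_le; apply/andP; split; last first.
  apply: ge_ereal_sup => _ [C [clC CU] <-]; rewrite lee_fin.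
  rewrite (solid_extension_open oU) (solid_extension_closed clC).
  by have := open_mass_cover clC oU CU; lra.
apply/lee_addgt0Pr => e e0; rewrite solid_extension_open//.
have [_ [s sU <-] lt] : exists2 x,
    [set \sum_(A <- s) lam_conn A | s in packing (@continuum X) U] x
    & open_mass U - e < x.
  apply: sup_adherent => //; split.
    by exists (\sum_(A <- [::]) lam_conn A); exists [::] => //; exact: packing_nil.
  by exists (lam setT) => _ [s sU <-]; apply: bound; exact: packingS sU.
have [djs cs subU] := sU.
have clS : closed (cup s) by apply: closed_cup => A /cs[].
have := mass_eq djs cs => mass_s.
apply: (@le_trans _ _ ((solid_extension (cup s))%:E + e%:E)%E).
  by rewrite -EFinD lee_fin solid_extension_closed//; lra.
by apply: leeD2r; apply: ereal_sup_ubound; exists (cup s).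
Qed.

Lemma solid_extension_topological_measure : topological_measure solid_extension.
Proof.
split; [exact: solid_extension_ge0|exact: solid_extensionU|].
exact: solid_extension_regular.
Qed.

Lemma solid_extension_extends : extends_solid lam solid_extension.
Proof.
move=> A [sA|sA].
  by rewrite solid_extension_open ?mass_solid//; case: sA.
rewrite solid_extension_closed; last by case: sA.
rewrite mass_solid; last exact: closed_solidC.
by rewrite (lamC hlam); [rewrite opprB addrC subrK|right].
Qed.

End existence.

(** * Uniqueness *)

Section uniqueness.
Context {R : realType} {X : topologicalType}.
Hypothesis Xcompact : compact [set: X].
Hypothesis Xhausdorff : hausdorff_space X.
Hypothesis Xconnected : connected [set: X].
Hypothesis Xlocconn : locally_connected X.
Variable lam : set X -> R.
Hypothesis hlam : solid_set_function lam.
Variable nu : set X -> R.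
Hypothesis hnu : topological_measure nu.
Hypothesis nu_lam : extends_solid lam nu.
Implicit Types (A B C G K U V W : set X) (s t : seq (set X)).

Local Notation open_mass := (open_mass lam).
Local Notation lam_conn := (lam_conn lam).

Lemma nuT : nu setT = lam setT.
Proof. by apply: nu_lam; left; exact: open_solidT. Qed.

Lemma nu0 : nu set0 = 0.
Proof.
by rewrite nu_lam ?(lam0 Xconnected hlam)//; left; exact: open_solid0.
Qed.

Lemma nuC A : open_or_closed A -> nu (~` A) = lam setT - nu A.
Proof.
move=> ocA; have [_ nuU _] := hnu.
rewrite -nuT -(setUv A) nuU ?setICr//; first by rewrite addrAC subrr add0r.
  by case: ocA; [right; exact: open_closedC|left; exact: closed_openC].
by rewrite setUv; left; exact: openT.
Qed.

Lemma nu_closed_le_open C U : closed C -> open U -> C `<=` U -> nu C <= nu U.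
Proof.
move=> clC oU CU; have [_ _ /(_ U oU) reg] := hnu.
by rewrite -lee_fin reg; apply: ereal_sup_ubound; exists C.
Qed.

Lemma nu_open_le U c : open U ->
  (forall C, closed C -> C `<=` U -> nu C <= c) -> nu U <= c.
Proof.
move=> oU cP; have [_ _ /(_ U oU) reg] := hnu.
rewrite -lee_fin reg; apply: ge_ereal_sup => _ [C [clC CU] <-].
by rewrite lee_fin; exact: cP.
Qed.

Lemma nu_closedS C D : closed C -> closed D -> C `<=` D -> nu C <= nu D.
Proof.
move=> clC clD CD.
have : nu (~` D) <= nu (~` C).
  apply: nu_open_le; first exact: closed_openC.
  move=> E clE ED; apply: nu_closed_le_open => //; first exact: closed_openC.
  exact: subset_trans ED (subsetC CD).
by rewrite !nuC; [lra|right|right].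
Qed.

(** Additivity on two sets asks that their union be open or closed, so all the
    members have to be of the same kind [P]. *)
Lemma nu_cup (P : set X -> Prop) s : P set0 ->
  (forall A B, P A -> P B -> P (A `|` B)) ->
  (forall A, P A -> open_or_closed A) ->
  disjoint_seq s -> (forall A, A \in s -> P A) ->
  nu (cup s) = \sum_(A <- s) nu A.
Proof.
move=> P0 PU Poc djs sP; have [_ nuU _] := hnu.
suff [] : P (cup s) /\ nu (cup s) = \sum_(A <- s) nu A by [].
elim: s djs sP => [|A s IHs]; first by rewrite cup_nil big_nil nu0.
rewrite disjoint_cons cup_cons big_cons => /andP[/eqP As djs] sP.
have PA : P A by apply: sP; exact: mem_head.
have [|Ps <-] := IHs djs; first by move=> B Bs; apply: sP; rewrite inE Bs orbT.
by split; [exact: PU|apply: nuU => //; apply: Poc => //; exact: PU].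
Qed.

Lemma nu_cup_closed s : disjoint_seq s -> (forall A, A \in s -> closed A) ->
  nu (cup s) = \sum_(A <- s) nu A.
Proof.
by apply: nu_cup; [exact: closed0|exact: closedU|move=> A; right].
Qed.

Lemma nu_cup_open s : disjoint_seq s -> (forall A, A \in s -> open A) ->
  nu (cup s) = \sum_(A <- s) nu A.
Proof.
by apply: nu_cup; [exact: open0|exact: openU|move=> A; left].
Qed.

(** By inner regularity and compactness, finitely many components of the
    complement of [C] carry almost all of its measure. *)
Lemma nu_continuum C : continuum C -> nu C = lam_conn C.
Proof.
move=> [clC cC C0]; have oCC : open (~` C) by exact: closed_openC.
suff : nu (~` C) = solid_pack lam (~` C).
  by rewrite /lam_conn nuC; [lra|right].
apply/eqP; rewrite eq_le; apply/andP; split; last first.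
  apply: pack_le => s [djs ss sC].
  have cls A : A \in s -> closed A by move=> /ss[].
  rewrite (eq_big_seq nu).
    by rewrite -nu_cup_closed//; apply: nu_closed_le_open => //; exact: closed_cup.
  by move=> A /ss sA; rewrite nu_lam//; right.
apply: nu_open_le => // K clK KC.
have [t [djt tc Kt]] := finite_component_cover Xlocconn oCC
  (closed_compact Xcompact clK) KC.
have st W : W \in t -> open_solid W.
  move=> /tc[x _ ->]; split; first exact: open_component.
  split; first exact: component_connected.
  exact: connected_setC_component.
have ot W : W \in t -> open W by move=> /st[].
apply: (@le_trans _ _ (nu (cup t))).
  by apply: nu_closed_le_open => //; exact: open_cup.
have pb := solid_pack_bound hlam.
apply: (@le_trans _ _ (solid_pack lam (cup t))); last first.
  by apply: (packS pb); apply: cup_sub => W /tc[x _ ->]; exact: connected_component_sub.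
rewrite nu_cup_open// [leRHS](pack_cup pb (@closed_solid_connected X))//.
rewrite !big_seq; apply: ler_sum => W Wt.
by rewrite [leRHS](solid_pack_open_solid hlam (st W Wt)) nu_lam//; left; exact: st.
Qed.

Lemma nu_open U : open U -> nu U = open_mass U.
Proof.
move=> oU; have sum_nu s : disjoint_seq s -> (forall A, A \in s -> continuum A) ->
    nu (cup s) = \sum_(A <- s) lam_conn A.
  move=> djs cs; rewrite nu_cup_closed//; last by move=> A /cs[].
  by apply: eq_big_seq => A /cs; exact: nu_continuum.
apply/eqP; rewrite eq_le; apply/andP; split.
  apply: nu_open_le => // K clK KU.
  have [s [djs cs Ks sU]] := continua_between Xcompact Xhausdorff Xlocconn clK oU KU.
  apply: (@le_trans _ _ (nu (cup s))).
    by apply: nu_closedS => //; apply: closed_cup => A /cs[].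
  rewrite sum_nu//; apply: (pack_ge (lam_conn_bound Xconnected Xlocconn hlam)).
  by split.
apply: pack_le => s [djs cs sU]; rewrite -sum_nu//.
by apply: nu_closed_le_open => //; apply: closed_cup => A /cs[].
Qed.

Lemma solid_extension_unique A : open_or_closed A -> nu A = solid_extension lam A.
Proof.
case=> [oA|clA]; first by rewrite solid_extension_open// nu_open.
rewrite solid_extension_closed// -nu_open; last exact: closed_openC.
by rewrite nuC; [rewrite opprB addrC subrK|right].
Qed.

End uniqueness.

Theorem theorem13p2 (R : realType) (X : topologicalType)
    (Xcompact : compact [set: X]) (Xconnected : connected [set: X])
    (Xlocconn : locally_connected X) (Xhausdorff : hausdorff_space X)
    (lam : set X -> R) (hlam : solid_set_function lam) :
  exists mu : set X -> R,
    [/\ topological_measure mu,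
        extends_solid lam mu
      & forall nu : set X -> R,
          topological_measure nu -> extends_solid lam nu ->
          forall A : set X, open_or_closed A -> nu A = mu A].
Proof.
exists (solid_extension lam); split.
- exact: solid_extension_topological_measure.
- exact: solid_extension_extends.
- by move=> nu hnu nu_lam A; exact: solid_extension_unique.
Qed.
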